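(* Let $\Bbbk$ be a field, let $\alpha,\beta,\gamma\in\Bbbk$, and let $A=A(\alpha,\beta,\gamma)$ be the corresponding down-up algebra. If $\beta\neq 0$, then $A$ is a PSF ring, i.e. every finitely generated projective $A$-module is stably free.
   Context: For a field $\Bbbk$ and $\alpha,\beta,\gamma\in\Bbbk$, the down-up algebra $A(\alpha,\beta,\gamma)$ is the associative unital $\Bbbk$-algebra generated by $U$ and $D$ subject to the relations $DU^2=\alpha UDU+\beta U^2D+\gamma U$ and $D^2U=\alpha DUD+\beta UD^2+\gamma D$. A module $P$ over a ring $S$ is stably free if $P\oplus S^m\cong S^n$ for some integers $m,n\geq 0$. A ring $S$ is a PSF ring if every finitely generated projective $S$-module is stably free. Modules are right modules. *)

(* Defs.v *)
From HB Require Import structures.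
From mathcomp Require Import all_boot all_order all_algebra.
From mathcomp Require Import finmap boolp.
From mathcomp Require Import monalg.

Set Implicit Arguments.
Unset Strict Implicit.
Unset Printing Implicit Defensive.

Import GRing.Theory.
Local Open Scope ring_scope.
Local Open Scope quotient_scope.

Definition fin_generated (R : pzRingType) (P : lmodType R) : Prop :=
  exists (n : nat) (g : 'I_n -> P),
    forall x : P, exists c : 'I_n -> R, x = \sum_(i < n) c i *: g i.

Definition projective (R : pzRingType) (P : lmodType R) : Prop :=
  forall (M N : lmodType R) (g : {linear M -> N}) (f : {linear P -> N}),
    (forall y : N, exists x : M, g x = y) ->
    exists h : {linear P -> M}, forall x : P, g (h x) = f x.

Definition stably_free (R : pzRingType) (P : lmodType R) : Prop :=
  exists (m n : nat) (f : {linear (P * 'rV[R]_m)%type -> 'rV[R]_n}),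
    bijective f.

(* Right S-modules are the left modules over the converse ring S^c; the free
   right module of rank n is then 'rV[S^c]_n. *)
Definition psf_ring (S : pzRingType) : Prop :=
  forall P : lmodType S^c, fin_generated P -> projective P -> stably_free P.

Definition is_ideal (R : pzRingType) (I : R -> Prop) : Prop :=
  [/\ I 0, (forall x y, I x -> I y -> I (x - y)),
      (forall a x, I x -> I (a * x)) & (forall a x, I x -> I (x * a))].

Definition ideal_gen (R : pzRingType) (X : R -> Prop) (x : R) : Prop :=
  forall I : R -> Prop, is_ideal I -> (forall y, X y -> I y) -> I x.

Lemma ideal_genP (R : pzRingType) (X : R -> Prop) : is_ideal (ideal_gen X).
Proof.
split=> [I [] //|x y Ix Iy I II XI|a x Ix I II XI|a x Ix I II XI];
  case: (II) => _ IB IMl IMr.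
- by apply: IB; [apply: Ix|apply: Iy].
- by apply: IMl; apply: Ix.
- by apply: IMr; apply: Ix.
Qed.

Lemma ideal_gen_sub (R : pzRingType) (X : R -> Prop) x : X x -> ideal_gen X x.
Proof. by move=> Xx I _; apply. Qed.

Section QuotientAlgebra.
Variables (R : pzRingType) (F : algType R) (X : F -> Prop).

Definition ideal_pred : {pred F} := fun x => `[< ideal_gen X x >].

Lemma ideal_pred_zmod : zmod_closed ideal_pred.
Proof.
have [I0 IB _ _] := ideal_genP X.
by split=> [|x y /asboolP Ix /asboolP Iy]; apply/asboolP => //; apply: IB.
Qed.
HB.instance Definition _ := GRing.isZmodClosed.Build F ideal_pred ideal_pred_zmod.

Lemma ideal_predMl a x : x \in ideal_pred -> a * x \in ideal_pred.
Proof.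
have [_ _ IM _] := ideal_genP X.
by move=> /asboolP Ix; apply/asboolP; apply: IM.
Qed.

Lemma ideal_predMr a x : x \in ideal_pred -> x * a \in ideal_pred.
Proof.
have [_ _ _ IM] := ideal_genP X.
by move=> /asboolP Ix; apply/asboolP; apply: IM.
Qed.

Lemma ideal_predZ c x : x \in ideal_pred -> c *: x \in ideal_pred.
Proof. by rewrite -mulr_algl; apply: ideal_predMl. Qed.

(* MathComp rings satisfy 1 != 0, hence the properness argument. *)
Definition alg_quot of ~ ideal_gen X 1 : Type := {ideal_quot ideal_pred}.

Hypothesis proper : ~ ideal_gen X 1.
Local Notation Q := (alg_quot proper).
HB.instance Definition _ := Choice.on Q.
HB.instance Definition _ := GRing.Zmodule.on Q.

Definition quot_pi : F -> Q := locked (fun x => \pi_({ideal_quot ideal_pred}) x).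
Definition quot_repr (x : Q) : F := repr (x : {ideal_quot ideal_pred}).

Lemma quot_reprK x : quot_pi (quot_repr x) = x.
Proof. by rewrite /quot_pi -lock /quot_repr reprK. Qed.

Lemma quot_piE x y : (quot_pi x = quot_pi y) <-> ideal_gen X (x - y).
Proof.
rewrite /quot_pi -lock; split=> [/eqP|Ixy].
  by rewrite -Quotient.idealrBE => /asboolP.
by apply/eqP; rewrite -Quotient.idealrBE; apply/asboolP.
Qed.

Lemma quot_piP x y : (quot_pi x = quot_pi y) <-> (x - y \in ideal_pred).
Proof. by rewrite quot_piE; split=> /asboolP. Qed.

Lemma quot_pi_onto x : exists y, x = quot_pi y.
Proof. by exists (quot_repr x); rewrite quot_reprK. Qed.

Lemma quot_piK x : quot_repr (quot_pi x) - x \in ideal_pred.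
Proof. by apply/quot_piP; rewrite quot_reprK. Qed.

Lemma quot_pi_zmod : zmod_morphism quot_pi.
Proof. by rewrite /quot_pi -lock; exact: (raddfB (\pi_({ideal_quot ideal_pred}))). Qed.
HB.instance Definition _ := GRing.isZmodMorphism.Build F Q quot_pi quot_pi_zmod.

Definition quot_mul : Q -> Q -> Q :=
  locked (fun x y => quot_pi (quot_repr x * quot_repr y)).
Definition quot_scale : R -> Q -> Q :=
  locked (fun c x => quot_pi (c *: quot_repr x)).

Lemma quot_mul_pi x y : quot_mul (quot_pi x) (quot_pi y) = quot_pi (x * y).
Proof.
rewrite /quot_mul -lock; apply/quot_piP; set x' := quot_repr _; set y' := quot_repr _.
have -> : x' * y' - x * y = x' * (y' - y) + (x' - x) * y.
  by rewrite mulrBr mulrBl addrA subrK.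
apply: rpredD.
  by apply: ideal_predMl; exact: quot_piK.
by apply: ideal_predMr; exact: quot_piK.
Qed.

Lemma quot_scale_pi c x : quot_scale c (quot_pi x) = quot_pi (c *: x).
Proof.
rewrite /quot_scale -lock; apply/quot_piP; rewrite -scalerBr.
by apply: ideal_predZ; exact: quot_piK.
Qed.

Lemma quot_mulA : associative quot_mul.
Proof.
move=> x y z; have [x' ->] := quot_pi_onto x.
have [y' ->] := quot_pi_onto y; have [z' ->] := quot_pi_onto z.
by rewrite !quot_mul_pi mulrA.
Qed.
Lemma quot_mul1 : left_id (quot_pi 1) quot_mul.
Proof. by move=> x; have [x' ->] := quot_pi_onto x; rewrite quot_mul_pi mul1r. Qed.
Lemma quot_mulr1 : right_id (quot_pi 1) quot_mul.
Proof. by move=> x; have [x' ->] := quot_pi_onto x; rewrite quot_mul_pi mulr1. Qed.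
Lemma quot_mulDl : left_distributive quot_mul +%R.
Proof.
move=> x y z; have [x' ->] := quot_pi_onto x.
have [y' ->] := quot_pi_onto y; have [z' ->] := quot_pi_onto z.
by rewrite -raddfD !quot_mul_pi mulrDl raddfD.
Qed.
Lemma quot_mulDr : right_distributive quot_mul +%R.
Proof.
move=> x y z; have [x' ->] := quot_pi_onto x.
have [y' ->] := quot_pi_onto y; have [z' ->] := quot_pi_onto z.
by rewrite -raddfD !quot_mul_pi mulrDr raddfD.
Qed.
Lemma quot_one_neq0 : quot_pi 1 != 0.
Proof.
rewrite -(raddf0 quot_pi); apply/eqP => /quot_piE.
by rewrite subr0.
Qed.
HB.instance Definition _ := GRing.Zmodule_isNzRing.Build Q
  quot_mulA quot_mul1 quot_mulr1 quot_mulDl quot_mulDr quot_one_neq0.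

Lemma quot_scaleA a b x : quot_scale a (quot_scale b x) = quot_scale (a * b) x.
Proof. by have [x' ->] := quot_pi_onto x; rewrite !quot_scale_pi scalerA. Qed.
Lemma quot_scale1 : left_id 1 quot_scale.
Proof. by move=> x; have [x' ->] := quot_pi_onto x; rewrite quot_scale_pi scale1r. Qed.
Lemma quot_scaleDr : right_distributive quot_scale +%R.
Proof.
move=> a x y; have [x' ->] := quot_pi_onto x; have [y' ->] := quot_pi_onto y.
by rewrite -raddfD !quot_scale_pi scalerDr raddfD.
Qed.
Lemma quot_scaleDl x a b : quot_scale (a + b) x = quot_scale a x + quot_scale b x.
Proof.
by have [x' ->] := quot_pi_onto x; rewrite !quot_scale_pi scalerDl raddfD.
Qed.
HB.instance Definition _ := GRing.Zmodule_isLmodule.Build R Q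
  quot_scaleA quot_scale1 quot_scaleDr quot_scaleDl.

Lemma quot_pi_monoid : monoid_morphism quot_pi.
Proof. by split=> [//|x y]; rewrite -quot_mul_pi. Qed.
HB.instance Definition _ := GRing.isMonoidMorphism.Build F Q quot_pi quot_pi_monoid.

Lemma quot_piZ : scalable quot_pi.
Proof. by move=> c x; rewrite -quot_scale_pi. Qed.
HB.instance Definition _ := GRing.isScalable.Build R F Q *:%R quot_pi quot_piZ.

Lemma quot_scaleAl (c : R) (x y : Q) : c *: (x * y) = (c *: x) * y.
Proof.
have [x' ->] := quot_pi_onto x; have [y' ->] := quot_pi_onto y.
by rewrite -rmorphM -!quot_piZ -rmorphM scalerAl.
Qed.
HB.instance Definition _ := GRing.Lmodule_isLalgebra.Build R Q quot_scaleAl.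

Lemma quot_scaleAr (c : R) (x y : Q) : c *: (x * y) = x * (c *: y).
Proof.
have [x' ->] := quot_pi_onto x; have [y' ->] := quot_pi_onto y.
by rewrite -rmorphM -!quot_piZ -rmorphM scalerAr.
Qed.
HB.instance Definition _ := GRing.Lalgebra_isAlgebra.Build R Q quot_scaleAr.

Lemma quot_pi_eq0 x : X x -> quot_pi x = 0.
Proof.
move=> Xx; rewrite -(raddf0 quot_pi); apply/quot_piE.
by rewrite subr0; apply: ideal_gen_sub.
Qed.

Lemma ideal_gen_ker (B : nzRingType) (f : {rmorphism F -> B}) x :
  (forall y, X y -> f y = 0) -> ideal_gen X x -> f x = 0.
Proof.
move=> Xf /(_ (fun y => f y = 0)); apply=> //; split=> [|y z|a y|a y].
- exact: raddf0.
- by rewrite rmorphB => -> ->; rewrite subr0.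
- by rewrite rmorphM => ->; rewrite mulr0.
- by rewrite rmorphM => ->; rewrite mul0r.
Qed.

Lemma quot_universal (B : algType R) (f : {lrmorphism F -> B}) :
  (forall x, X x -> f x = 0) ->
  exists g : {lrmorphism Q -> B}, forall x, g (quot_pi x) = f x.
Proof.
move=> Xf; pose g x := f (quot_repr x).
have gE x : g (quot_pi x) = f x.
  apply/eqP; rewrite -subr_eq0 -raddfB; apply/eqP/(ideal_gen_ker Xf).
  by apply/asboolP; exact: quot_piK.
have gB : zmod_morphism g.
  move=> x y; have [x' ->] := quot_pi_onto x; have [y' ->] := quot_pi_onto y.
  by rewrite -raddfB !gE raddfB.
have gM : monoid_morphism g.
  split=> [|x y]; first by rewrite -(rmorph1 quot_pi) gE rmorph1.
  have [x' ->] := quot_pi_onto x; have [y' ->] := quot_pi_onto y.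
  by rewrite -rmorphM !gE rmorphM.
have gZ : scalable g.
  by move=> c x; have [x' ->] := quot_pi_onto x; rewrite -linearZ !gE linearZ.
pose aB := GRing.isZmodMorphism.Build _ _ g gB.
pose aM := GRing.isMonoidMorphism.Build _ _ g gM.
pose aZ := GRing.isScalable.Build R _ _ *:%R g gZ.
pose h : {lrmorphism Q -> B} := HB.pack g aB aM aZ.
by exists h.
Qed.

End QuotientAlgebra.

(* The free algebra k<U, D>: the monoid algebra of the free monoid on two
   letters, U being the letter true and D the letter false. *)
Definition free2 (k : fieldType) : Type := {malg k[{fmonom bool}]}.

Section Free.
Variable k : fieldType.

HB.instance Definition _ := GRing.Lalgebra.on (free2 k).

Lemma free2_scaleAr (c : k) (x y : free2 k) : c *: (x * y) = x * (c *: y).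
Proof.
have mulC (z : {malg k[{fmonom bool}]}) : z * c%:MP = c *: z.
  rewrite malgM_def fgmulgU malgZ_def; apply: eq_bigr => i _.
  by rewrite mulm1 mulrC.
by have := mulrA (x : {malg k[{fmonom bool}]}) y c%:MP; rewrite !mulC.
Qed.
HB.instance Definition _ :=
  GRing.Lalgebra_isAlgebra.Build k (free2 k) free2_scaleAr.

Definition freeU : free2 k := << fmu true >>.
Definition freeD : free2 k := << fmu false >>.

Section Eval.
Variables (B : algType k) (u d : B).

Definition word_eval (m : {fmonom bool}) : B :=
  \prod_(b <- (m : seq bool)) (if b then u else d).

Lemma word_evalM : mmorphism word_eval.
Proof.
split=> [x y|]; rewrite /word_eval; last by rewrite fm1 big_nil.
by rewrite fmM big_cat.
Qed.
HB.instance Definition _ := isMultiplicative.Build _ _ word_eval word_evalM.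

Definition free2_eval (x : free2 k) : B := mmap (in_alg B) word_eval x.

Lemma free2_eval_zmod : zmod_morphism free2_eval.
Proof. exact: raddfB. Qed.
HB.instance Definition _ :=
  GRing.isZmodMorphism.Build (free2 k) B free2_eval free2_eval_zmod.

Lemma free2_eval_monoid : monoid_morphism free2_eval.
Proof.
have [|MM M1] := @commr_mmap_is_multiplicative _ _ _ (in_alg B) word_eval.
  by move=> g m m'; rewrite /GRing.comm /= mulr_algl mulr_algr.
by split.
Qed.
HB.instance Definition _ :=
  GRing.isMonoidMorphism.Build (free2 k) B free2_eval free2_eval_monoid.

Lemma free2_evalZ : scalable free2_eval.
Proof. by move=> c x; rewrite /free2_eval mmapZ /= mulr_algl. Qed.
HB.instance Definition _ :=
  GRing.isScalable.Build k (free2 k) B *:%R free2_eval free2_evalZ.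

Lemma free2_evalU : free2_eval freeU = u.
Proof.
by rewrite /free2_eval /freeU mmapU /= scale1r mul1r /word_eval fmU big_seq1.
Qed.

Lemma free2_evalD : free2_eval freeD = d.
Proof.
by rewrite /free2_eval /freeD mmapU /= scale1r mul1r /word_eval fmU big_seq1.
Qed.

Lemma free2_ext (f g : {lrmorphism free2 k -> B}) :
  f freeU = g freeU -> f freeD = g freeD -> f =1 g.
Proof.
move=> fgU fgD x.
have hZ (h : {lrmorphism free2 k -> B}) c m :
    h << c *g m >> = c *: h (<< m >> : free2 k).
  rewrite -linearZ; congr (h _).
  have := @mul_malgC {fmonom bool} k c << m >>.
  by rewrite malgM_def fgmulUU mulr1 mul1m.
have h1 (h : {lrmorphism free2 k -> B}) : h << FMonom [::] >> = 1.
  rewrite -(rmorph1 h); congr (h << _ >>).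
  by apply/val_inj; rewrite /= fm1.
have hS (h : {lrmorphism free2 k -> B}) b s :
    h << FMonom (b :: s) >> = h (<< fmu b >> : free2 k) * h << FMonom s >>.
  rewrite -rmorphM; congr (h _).
  have := @fgmulUU {fmonom bool} k 1 1 (fmu b) (FMonom s).
  rewrite mulr1 => mE; apply: etrans (esym mE); congr << _ >>.
  by apply/val_inj; rewrite /= fmM fmU.
have fg c m : f << c *g m >> = g << c *g m >>.
  apply: etrans (hZ f c m) _; apply: etrans _ (esym (hZ g c m)).
  congr (_ *: _); case: m; elim=> [|b s IHs].
    exact: etrans (h1 f) (esym (h1 g)).
  apply: etrans (hS f b s) _; apply: etrans _ (esym (hS g b s)).
  by congr (_ * _); [case: b | exact: IHs].
rewrite [x]monalgE (raddf_sum f) (raddf_sum g).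
by apply: eq_bigr => m _; exact: fg.
Qed.
End Eval.

End Free.

Section DownUp.
Variables (k : fieldType) (alpha beta gamma : k).

Definition relator1 (B : algType k) (U D : B) : B :=
  D * U ^+ 2 - (alpha *: (U * D * U) + beta *: (U ^+ 2 * D) + gamma *: U).
Definition relator2 (B : algType k) (U D : B) : B :=
  D ^+ 2 * U - (alpha *: (D * U * D) + beta *: (U * D ^+ 2) + gamma *: D).

Definition downup_relators (x : free2 k) : Prop :=
  x = relator1 (freeU k) (freeD k) \/ x = relator2 (freeU k) (freeD k).

Lemma rmorph_relator1 (B C : algType k) (f : {lrmorphism B -> C}) u d :
  f (relator1 u d) = relator1 (f u) (f d).
Proof. by rewrite /relator1 !expr2 linearB !linearD !linearZ /= !rmorphM. Qed.

Lemma rmorph_relator2 (B C : algType k) (f : {lrmorphism B -> C}) u d :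
  f (relator2 u d) = relator2 (f u) (f d).
Proof. by rewrite /relator2 !expr2 linearB !linearD !linearZ /= !rmorphM. Qed.

Lemma eval_relators (B : algType k) (u d : B) x :
  relator1 u d = 0 -> relator2 u d = 0 -> downup_relators x ->
  free2_eval u d x = 0.
Proof.
pose f : {lrmorphism free2 k -> B} := free2_eval u d.
have fU : f (freeU k) = u := free2_evalU u d.
have fD : f (freeD k) = d := free2_evalD u d.
move=> r1 r2 [] ->.
  by apply: etrans (rmorph_relator1 f _ _) _; rewrite fU fD.
by apply: etrans (rmorph_relator2 f _ _) _; rewrite fU fD.
Qed.

Lemma downup_proper : ~ ideal_gen downup_relators 1.
Proof.
move=> I1; have /eqP := oner_neq0 k; apply.
rewrite -(rmorph1 (free2_eval (0 : k^o) 0)).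
apply: (ideal_gen_ker (f := free2_eval (0 : k^o) 0)) I1 => x.
by apply: eval_relators;
  rewrite /relator1 /relator2 ?expr2 !(mulr0, mul0r, scaler0, addr0, subr0).
Qed.

Definition downup : algType k := alg_quot downup_proper.

Definition downupU : downup := quot_pi downup_proper (freeU k).
Definition downupD : downup := quot_pi downup_proper (freeD k).

Lemma downup_rel1 :
  downupD * downupU ^+ 2 =
  alpha *: (downupU * downupD * downupU) + beta *: (downupU ^+ 2 * downupD)
  + gamma *: downupU.
Proof.
apply/eqP; rewrite -subr_eq0 -/(relator1 _ _) -rmorph_relator1.
by apply/eqP/quot_pi_eq0; left.
Qed.

Lemma downup_rel2 :
  downupD ^+ 2 * downupU =
  alpha *: (downupD * downupU * downupD) + beta *: (downupU * downupD ^+ 2)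
  + gamma *: downupD.
Proof.
apply/eqP; rewrite -subr_eq0 -/(relator2 _ _) -rmorph_relator2.
by apply/eqP/quot_pi_eq0; right.
Qed.

Lemma downup_universal (B : algType k) (u d : B) :
  d * u ^+ 2 = alpha *: (u * d * u) + beta *: (u ^+ 2 * d) + gamma *: u ->
  d ^+ 2 * u = alpha *: (d * u * d) + beta *: (u * d ^+ 2) + gamma *: d ->
  exists f : {lrmorphism downup -> B}, f downupU = u /\ f downupD = d.
Proof.
move=> r1 r2; have [|f fE] := quot_universal downup_proper (f := free2_eval u d).
  by move=> x; apply: eval_relators; rewrite /relator1 /relator2 (r1, r2) subrr.
exists f; split; apply: etrans (fE _) _.
  exact: free2_evalU.
exact: free2_evalD.
Qed.

Lemma downup_ext (B : algType k) (f g : {lrmorphism downup -> B}) :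
  f downupU = g downupU -> f downupD = g downupD -> f =1 g.
Proof.
move=> fgU fgD x; have [y ->] := quot_pi_onto x.
by apply: (free2_ext (f := f \o quot_pi downup_proper)
                     (g := g \o quot_pi downup_proper)).
Qed.

End DownUp.

(* Main.v *)
Require Import Defs.
From HB Require Import structures.
From mathcomp Require Import all_boot all_order all_algebra.
From mathcomp Require Import finmap boolp monalg.
From mathcomp Require Import zify ring.

Set Implicit Arguments.
Unset Strict Implicit.
Unset Printing Implicit Defensive.

Import Order.TTheory GRing.Theory Num.Theory.
Local Open Scope ring_scope.

(** Right modules over the down-up algebra are left modules over its converse
ring C, in which u and d stand for U and D.  The proof is a filtered Hilbert
syzygy theorem for C: every finitely generated left C-module P has a resolution
0 -> F4 -> F3 -> F2 -> F1 -> F0 -> P -> 0 by finite free modules.  When P is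
projective the resolution is contractible, and P + F1 + F3 is isomorphic to
F0 + F2 + F4 ([resolution_stably_free]).

Filter C by the length of words in u and d.  Three facts produce the resolution.

- Exactness.  Write the two defining relations as u r1 + d s1 = 0 and
  u r2 + d s2 = 0.  They are linked by a single relation, which gives for each
  left module M a complex M -> M^2 -> M^2 -> M, with the maps
  c |-> (d c, - beta u c), (a, b) |-> (syzygyU a b, syzygyD a b) and
  (p, q) |-> u p + d q.  For M = C it is exact with the expected bounds on
  degrees; [koszul_exact3], ..., [koszul_exact0] state this at each spot, for
  a module with a filtration.  If K is the kernel of a filtered surjection of a
  free module onto M, then K is exact at spot 3, and exactness of M at one spot
  gives exactness of K at the next one to the right; so four steps of a
  resolution make spots 0 and 1 exact whatever the initial module was.

- Freeness.  If spots 0 and 1 of M are exact, a generating family of minimal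
  size is a basis ([minimal_generators]): a relation has no constant
  coefficient in top degree, since this would allow to drop a generator, hence
  it is u p + d q up to lower degree, and exactness lowers its degree until it
  vanishes.

- Finiteness.  A submodule of a free module is generated by finitely many
  elements, with control of degrees ([submodule_generated]): its leading
  monomials live in finitely many copies of nat^3, to which Dickson's lemma
  applies.

All computations in C are made in an explicit model, in which C acts on the
functions from int to k[x, y].  This is the presentation of C as a generalized
Weyl algebra: u shifts a function up and d shifts it down, and the diagonal
operators u d and d u multiply the value at position n by two affine forms
[weight n] and [weight (n + 1)].  The weights satisfy a linear recurrence of
order two; beta != 0 allows to run it in both directions, which makes two
consecutive weights coordinates of the affine plane.  In the model the degree
filtration is visible on coefficients, and exactness is checked position by
position. *)

(** * Weights *)

Section Weights.
Variables (k : fieldType) (alpha beta gamma : k).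
Local Notation R := {poly {poly k}}.
Local Notation cst c := (c%:P%:P : R).

Definition vx : R := 'X.
Definition vy : R := 'X%:P.

(** The recurrence acts on pairs of consecutive weights, and these two maps are
inverse to each other; this is where beta != 0 enters. *)
Definition weight_up (s : R * R) : R * R :=
  (s.2, cst beta^-1 * (s.1 - cst alpha * s.2 - cst gamma)).
Definition weight_down (s : R * R) : R * R :=
  (cst alpha * s.1 + cst beta * s.2 + cst gamma, s.1).

Definition weight_pair (n : int) : R * R :=
  match n with
  | Posz m => iter m weight_up (vx, vy)
  | Negz m => iter m.+1 weight_down (vx, vy)
  end.
Definition weight (n : int) : R := (weight_pair n).1.

Hypothesis beta_neq0 : beta != 0.

Lemma weight_upK : cancel weight_up weight_down.
Proof.
move=> [s t]; rewrite /weight_up /weight_down /=; congr pair.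
rewrite mulrA -!polyCM divff // mul1r; ring.
Qed.

Lemma weight_downK : cancel weight_down weight_up.
Proof.
move=> [s t]; rewrite /weight_up /weight_down /=; congr pair.
have -> : cst alpha * s + cst beta * t + cst gamma - cst alpha * s - cst gamma
  = cst beta * t by ring.
by rewrite mulrA -!polyCM mulVf // mul1r.
Qed.

Lemma weight_pairS n : weight_pair (n + 1) = weight_up (weight_pair n).
Proof.
case: n => [m|[|m]].
- have -> : Posz m + 1 = Posz m.+1 by lia. done.
- by rewrite /= weight_downK.
have -> : Negz m.+1 + 1 = Negz m by lia.
by rewrite [in RHS]/= weight_downK.
Qed.

Lemma weight_pair2 n : (weight_pair n).2 = weight (n + 1).
Proof. by rewrite /weight weight_pairS. Qed.

Lemma weight0 : weight 0 = vx. Proof. by []. Qed.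
Lemma weight1 : weight 1 = vy. Proof. by []. Qed.

Lemma weight_rec n :
  weight n = cst alpha * weight (n + 1) + cst beta * weight (n + 2) + cst gamma.
Proof.
have e : weight_pair n = weight_down (weight_pair (n + 1)) by rewrite weight_pairS weight_upK.
have -> : n + 2 = n + 1 + 1 by lia.
by rewrite {1}/weight e /= weight_pair2.
Qed.

Lemma int_shift_ind (P : int -> Prop) :
  P 0 -> (forall n, P n -> P (n + 1)) -> (forall n, P (n + 1) -> P n) ->
  forall n, P n.
Proof.
move=> P0 Pu Pd n; elim/int_rect: n => [//|n Pn|n Pn].
  have -> : Posz n.+1 = n%:Z + 1 by lia.
  exact: Pu.
by apply: Pd; have -> : - n.+1%:Z + 1 = - n%:Z by lia.
Qed.

Definition affine (r : R) :=
  exists p q c : k, r = cst p * vx + cst q * vy + cst c.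

Lemma affine_comb p q c r s :
  affine r -> affine s -> affine (cst p * r + cst q * s + cst c).
Proof.
move=> [p1 [q1 [c1 ->]]] [p2 [q2 [c2 ->]]].
exists (p * p1 + q * p2), (p * q1 + q * q2), (p * c1 + q * c2 + c).
rewrite !polyCD !polyCM; ring.
Qed.

Lemma weight_affine n : affine (weight n).
Proof.
suff: affine (weight n) /\ affine (weight (n + 1)) by case.
elim/int_shift_ind: n => [|n [a0 a1]|n [a0 a1]].
- split; [exists 1, 0, 0|exists 0, 1, 0]; rewrite ?add0r ?weight0 ?weight1 ?polyC0 ?polyC1; ring.
- split=> //; have e : weight (n + 1 + 1) =
     cst beta^-1 * weight n + cst (- beta^-1 * alpha) * weight (n + 1) + cst (- beta^-1 * gamma).
    rewrite -weight_pair2 weight_pairS /= weight_pair2 -/(weight n) !(polyCM, polyCN); ring.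
  by rewrite e; apply: affine_comb.
- split=> //; rewrite weight_rec; apply: affine_comb => //.
  by have -> : n + 2 = n + 1 + 1 by lia.
Qed.

(** Going from the pair (weight n, weight (n + 1)) to a neighbouring one is an
invertible affine substitution, so all these pairs span the same affine forms as
(x, y). *)
Lemma weight_span p q n : exists p' q' c' : k,
  cst p * vx + cst q * vy = cst p' * weight n + cst q' * weight (n + 1) + cst c'.
Proof.
elim/int_shift_ind: n => [|n [p1 [q1 [c1 ->]]]|n [p1 [q1 [c1 ->]]]].
- by exists p, q, 0; rewrite weight0 weight1 !polyC0 addr0.
- exists (p1 * alpha + q1), (p1 * beta), (c1 + p1 * gamma).
  have -> : n + 1 + 1 = n + 2 by lia.
  rewrite (weight_rec n) !polyCD !polyCM; ring.
exists (q1 / beta), (p1 - q1 / beta * alpha), (c1 - q1 / beta * gamma).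
rewrite (weight_rec n); have -> : n + 2 = n + 1 + 1 by lia.
rewrite !polyCD !polyCN !polyCM.
have e : cst beta^-1 * cst beta = 1 by rewrite -!polyCM mulVf.
rewrite !mulrDr; rewrite [_ * (cst beta * _)]mulrA -[_ * cst beta^-1 * cst beta]mulrA e; ring.
Qed.

Lemma coef_affine p q c :
  let r : R := cst p * vx + cst q * vy + cst c in
  [/\ r`_1`_0 = p, r`_0`_1 = q & r`_0`_0 = c].
Proof.
have cE : let r : R := cst p * vx + cst q * vy + cst c in
    forall a b, r`_a`_b = p *+ ((a == 1) && (b == 0))%N + q *+ ((a == 0) && (b == 1))%N
      + c *+ ((a == 0) && (b == 0))%N.
  move=> /= a b; rewrite /vx /vy !coefD !coefCM coefX !coefC.
  case: a => [|[|a]] /=; rewrite ?mulr1 ?mulr0 ?coef0 ?coefD ?coefCM ?coefX ?coefC.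
  - by case: b => [|[|b]] /=; rewrite ?mulr1 ?mulr0 ?mulr1n ?mulr0n ?addr0 ?add0r.
  - by case: b => [|b] /=; rewrite ?mulr1 ?mulr0 ?mulr1n ?mulr0n ?addr0 ?add0r.
  - by rewrite ?mulr1 ?mulr0 ?mulr1n ?mulr0n ?addr0 ?add0r.
by split; rewrite cE /= ?mulr1n ?mulr0n ?addr0 ?add0r.
Qed.

(** If weight n vanished, then x and y would both be affine in the single form
weight (n + 1); their linear parts would be proportional. *)
Lemma weight_neq0 n : weight n != 0.
Proof.
apply/eqP=> w0.
have [p1 [q1 [c1]]] := weight_span 1 0 n; have [p2 [q2 [c2]]] := weight_span 0 1 n.
rewrite w0 !mulr0 !add0r.
have [p [q [c ->]]] := weight_affine (n + 1).
have aff q' c' : cst q' * (cst p * vx + cst q * vy + cst c) + cst c' =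
  cst (q' * p) * vx + cst (q' * q) * vy + cst (q' * c + c').
  rewrite !polyCD !polyCM; ring.
rewrite !aff => e2 e1.
have [] := coef_affine 0 1 0; have [] := coef_affine 1 0 0.
rewrite !polyC0 !addr0 e1 e2 /=.
have [/= -> -> _] := coef_affine (q1 * p) (q1 * q) (q1 * c + c1).
have [/= -> -> _] := coef_affine (q2 * p) (q2 * q) (q2 * c + c2).
move=> h1 h2 _ h3 h4 _.
have : (q1 * p) * (q2 * q) = 1 by rewrite h1 h4 mulr1.
have -> : (q1 * p) * (q2 * q) = (q1 * q) * (q2 * p) by ring.
by rewrite h2 mul0r => /eqP; rewrite eq_sym oner_eq0.
Qed.

End Weights.

(** * Total degree of polynomials in two variables *)

Section TotalDegree.
Variable k : fieldType.
Local Notation R := {poly {poly k}}.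
Local Notation cst c := (c%:P%:P : R).
Local Notation x := (vx k).
Local Notation y := (vy k).

(** The variables have degree 2, since they are to stand for the words u d and
d u.  Bounds are integers: negative ones force r = 0, which spares the case
distinctions of truncated subtraction. *)
Definition wdeg (n : int) (r : R) :=
  forall a b : nat, n < ((a + b) * 2)%N%:Z -> r`_a`_b = 0.

Lemma coef_cstM c (r : R) a b : (cst c * r)`_a`_b = c * r`_a`_b.
Proof. by rewrite !coefCM. Qed.

Lemma coef_vxM (r : R) a b : (x * r)`_a`_b = if a is a'.+1 then r`_a'`_b else 0.
Proof. by rewrite coefXM; case: a => [|a] //=; rewrite coef0. Qed.

Lemma coef_vyM (r : R) a b : (y * r)`_a`_b = if b is b'.+1 then r`_a`_b' else 0.
Proof. by rewrite coefCM coefXM; case: b. Qed.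

Lemma coef_cst c a b : (cst c)`_a`_b = if (a == 0)%N && (b == 0)%N then c else 0.
Proof. by rewrite coefC; case: a => [|a] /=; rewrite ?coef0 ?coefC. Qed.

Lemma wdeg0 n : wdeg n 0.
Proof. by move=> a b _; rewrite !coef0. Qed.

Lemma wdegD n r s : wdeg n r -> wdeg n s -> wdeg n (r + s).
Proof. by move=> hr hs a b h; rewrite !coefD hr ?hs ?addr0. Qed.

Lemma wdegN n r : wdeg n r -> wdeg n (- r).
Proof. by move=> hr a b h; rewrite !coefN hr ?oppr0. Qed.

Lemma wdegB n r s : wdeg n r -> wdeg n s -> wdeg n (r - s).
Proof. by move=> hr /wdegN; apply: wdegD. Qed.

Lemma wdegZ n c r : wdeg n r -> wdeg n (cst c * r).
Proof. by move=> hr a b h; rewrite coef_cstM hr ?mulr0. Qed.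

Lemma wdegW m n r : m <= n -> wdeg m r -> wdeg n r.
Proof. by move=> mn hr a b h; apply: hr; lia. Qed.

Lemma wdeg_lt0 n r : n < 0 -> wdeg n r -> r = 0.
Proof.
by move=> n0 hr; apply/polyP=> a; apply/polyP=> b; rewrite hr ?coef0 //; lia.
Qed.

Lemma wdeg_x n r : wdeg n (x * r) <-> wdeg (n - 2) r.
Proof.
split=> hr a b h; last by rewrite coef_vxM; case: a h => [|a] h //; apply: hr; lia.
by have := hr a.+1 b; rewrite coef_vxM; apply; lia.
Qed.

Lemma wdeg_y n r : wdeg n (y * r) <-> wdeg (n - 2) r.
Proof.
split=> hr a b h; last by rewrite coef_vyM; case: b h => [|b] h //; apply: hr; lia.
by have := hr a b.+1; rewrite coef_vyM; apply; lia.
Qed.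

Lemma wdeg_affine n s r : affine s -> wdeg n r -> wdeg (n + 2) (s * r).
Proof.
move=> [p [q [c ->]]] hr; rewrite !mulrDl -!mulrA.
have hr2 : wdeg (n + 2 - 2) r by apply: wdegW hr; lia.
by apply: wdegD; [apply: wdegD|]; apply: wdegZ;
  [apply/wdeg_x|apply/wdeg_y|apply: wdegW hr; lia].
Qed.

(** x s collects the monomials divisible by x, and y t the powers of y. *)
Lemma wdeg_split n r : wdeg n r -> r`_0`_0 = 0 ->
  exists s t, [/\ wdeg (n - 2) s, wdeg (n - 2) t & r = x * s + y * t].
Proof.
move=> hr r0; exists (\poly_(i < size r) r`_i.+1), (\poly_(j < size r`_0) r`_0`_j.+1)%:P.
split.
- move=> a b h; rewrite coef_poly; case: ifP => _; last by rewrite coef0.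
  by apply: hr; lia.
- move=> a b h; rewrite coefC; case: a h => [|a] h /=; last by rewrite coef0.
  by rewrite coef_poly; case: ifP => // _; apply: hr; lia.
apply/polyP=> a; apply/polyP=> b; rewrite !coefD coef_vxM coef_vyM.
case: a => [|a].
  rewrite add0r; case: b => [//|b]; rewrite coefC /= coef_poly; case: ltnP => // h.
  by rewrite nth_default //; lia.
have -> : r`_a.+1 = if (a < size r)%N then r`_a.+1 else 0.
  by case: ltnP => // h; rewrite nth_default //; apply: leqW.
by rewrite coef_poly; case: b => [|b]; rewrite ?addr0 // coefC /= coef0 addr0.
Qed.

Lemma vxy_coprime (p q : R) : x * p + y * q = 0 ->
  exists s, p = y * s /\ q = - (x * s).
Proof.
move=> e; have q0 : q`_0 = 0.
  have /(congr1 (fun r : R => r`_0)) := e.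
  rewrite coefD coefXM /= add0r coefCM coef0 => /eqP.
  by rewrite mulf_eq0 polyX_eq0 => /eqP.
have : root q 0 by rewrite rootE horner_coef0 q0.
case/factor_theorem=> s; rewrite subr0 => qE.
exists (- s); split; last by rewrite mulrN opprK qE mulrC.
have x0 : x != 0 by rewrite polyX_eq0.
apply: (mulfI x0); apply/eqP; rewrite -subr_eq0 -e qE; apply/eqP; rewrite /vx; ring.
Qed.

(** Position j of the model holds the multiples of u^j or d^(-j), which already
have length |j|. *)
Definition model_fil (n : int) (w : (int -> R)) := forall j, wdeg (n - `|j|%:Z) (w j).

Lemma model_fil_lt0 n w : n < 0 -> model_fil n w -> forall j, w j = 0.
Proof. by move=> n0 hw j; apply: wdeg_lt0 (hw j); lia. Qed.

Lemma model_filW m n w : m <= n -> model_fil m w -> model_fil n w.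
Proof. by move=> mn hw j; apply: wdegW (hw j); lia. Qed.

Definition delta0 : int -> R := fun n => if n == 0 then 1 else 0.

End TotalDegree.

(** * The model and its exactness *)

Section Model.
Variables (k : fieldType) (alpha beta gamma : k).
Local Notation R := {poly {poly k}}.
Local Notation cst c := (c%:P%:P : R).
Local Notation x := (vx k).
Local Notation y := (vy k).
Local Notation wt := (weight alpha beta gamma).
Local Notation V := (int -> R).

(** Position n stands for u^n if n >= 0 and for d^(-n) if n <= 0.  Multiplying by
u produces the next power of u for free, but turns d^(m+1) into u d d^m, where
u d acts diagonally through a weight; symmetrically for d. *)
Definition ucoef (n : int) : R := if 1 <= n then 1 else wt n.
Definition dcoef (n : int) : R := if n < 0 then 1 else wt (n + 1).
Definition model_u (w : V) : V := fun n => ucoef n * w (n - 1).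
Definition model_d (w : V) : V := fun n => dcoef n * w (n + 1).

Lemma ucoef_pos n : 1 <= n -> ucoef n = 1. Proof. by rewrite /ucoef => ->. Qed.
Lemma ucoef_neg n : n <= 0 -> ucoef n = wt n.
Proof. by rewrite /ucoef; case: ifP => //; lia. Qed.
Lemma dcoef_neg n : n < 0 -> dcoef n = 1. Proof. by rewrite /dcoef => ->. Qed.
Lemma dcoef_pos n : 0 <= n -> dcoef n = wt (n + 1).
Proof. by rewrite /dcoef; case: ifP => //; lia. Qed.

(** The model is generated by [delta0] under the two shifts, with control of the
degree: a positive position comes from u, a negative one from d, and at position
0 the multiples of x = u d and y = d u come from both. *)
Lemma model_split n w : model_fil n w ->
  exists p q, [/\ model_fil (n - 1) p, model_fil (n - 1) q &
    forall j, w j = cst (w 0)`_0`_0 * delta0 k j + model_u p j + model_d q j].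
Proof.
move=> hw; set c := (w 0)`_0`_0.
have wc : wdeg n (w 0 - cst c).
  apply: wdegB; first by apply: wdegW (hw 0); lia.
  case: (lerP 0 n) => n0; last by rewrite /c (model_fil_lt0 n0 hw) !coef0; apply: wdeg0.
  by move=> a b h; rewrite coef_cst; case: ifP => //; lia.
have [|s [t [hs ht st]]] := wdeg_split wc; first by rewrite !coefB coef_cst /= subrr.
have w0 : w 0 = cst c + x * s + y * t by rewrite -addrA -st addrC subrK.
exists (fun m => if 0 <= m then w (m + 1) else if m == -1 then s else 0).
exists (fun m => if m <= 0 then w (m - 1) else if m == 1 then t else 0).
split=> [j|j|j].
- case: ifP => h0; first by apply: wdegW (hw _); lia.
  case: eqP => [-> |_]; last exact: wdeg0.
  by apply: wdegW hs; lia.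
- case: ifP => h0; first by apply: wdegW (hw _); lia.
  case: eqP => [-> |_]; last exact: wdeg0.
  by apply: wdegW ht; lia.
rewrite /model_u /model_d /delta0; case: (ltrgtP j 0) => h.
- repeat (case: ifP => ?; try lia).
  rewrite dcoef_neg // !(mulr0, addr0, add0r, mul1r); congr w; lia.
- repeat (case: ifP => ?; try lia).
  rewrite ucoef_pos ?mulr0 ?mul1r ?addr0 ?add0r; last lia.
  congr w; lia.
rewrite h w0 /= mulr1 ucoef_neg // dcoef_pos // weight0 add0r weight1 //.
Qed.

(** By [model_split] the only obstruction is the constant term at position 0; it
vanishes, since u p + d q has the value x p (-1) + y q 1 there. *)
Lemma model_exact0 n p q : model_fil n p -> model_fil n q ->
  model_fil n (fun j => model_u p j + model_d q j) ->
  exists p' q', [/\ model_fil (n - 1) p', model_fil (n - 1) q' &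
    forall j, model_u p j + model_d q j = model_u p' j + model_d q' j].
Proof.
move=> hp hq /model_split [p' [q' [hp' hq' e]]].
exists p', q'; split=> // j; rewrite e.
rewrite {1}/model_u {1}/model_d ucoef_neg // dcoef_pos // weight0 add0r weight1 //.
by rewrite !coefD coef_vxM coef_vyM addr0 !polyC0 mul0r add0r.
Qed.

Hypothesis beta_neq0 : beta != 0.

Lemma ucoef_neq0 n : ucoef n != 0.
Proof. by rewrite /ucoef; case: ifP => _; rewrite ?oner_eq0 ?weight_neq0. Qed.

Lemma model_ud w n : model_u (model_d w) n = wt n * w n.
Proof.
rewrite /model_u /model_d mulrA; have -> : n - 1 + 1 = n by lia.
congr (_ * _); case: (lerP 1 n) => h.
  rewrite ucoef_pos // dcoef_pos; last lia.
  by rewrite mul1r; congr wt; lia.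
by rewrite ucoef_neg ?dcoef_neg ?mulr1 //; lia.
Qed.

Lemma model_du w n : model_d (model_u w) n = wt (n + 1) * w n.
Proof.
rewrite /model_u /model_d mulrA; have -> : n + 1 - 1 = n by lia.
congr (_ * _); case: (ltrP n 0) => h.
  by rewrite dcoef_neg // ucoef_neg ?mul1r //; lia.
by rewrite dcoef_pos // ucoef_pos ?mulr1 //; lia.
Qed.

Lemma model_uud w n : model_u (model_u (model_d w)) n =
  cst alpha * model_u (model_d (model_u w)) n
  + cst beta * model_d (model_u (model_u w)) n + cst gamma * model_u w n.
Proof.
rewrite model_ud model_du.
have -> : model_u (model_u (model_d w)) n = ucoef n * (wt (n - 1) * w (n - 1)).
  by rewrite {1}/model_u model_ud.
rewrite /model_u.
rewrite (weight_rec alpha gamma beta_neq0 (n - 1)).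
have -> : n - 1 + 1 = n by lia.
have -> : n - 1 + 2 = n + 1 by lia.
ring.
Qed.

Lemma model_udd w n : model_u (model_d (model_d w)) n =
  cst alpha * model_d (model_u (model_d w)) n
  + cst beta * model_d (model_d (model_u w)) n + cst gamma * model_d w n.
Proof.
rewrite model_ud model_du.
have -> : model_d (model_d (model_u w)) n = dcoef n * (wt (n + 1 + 1) * w (n + 1)).
  by rewrite {1}/model_d model_du.
rewrite /model_d.
rewrite (weight_rec alpha gamma beta_neq0 n).
have -> : n + 1 + 1 = n + 2 by lia.
ring.
Qed.

(** The relation u u d = alpha u d u + beta d u u + gamma u is
u (u d - alpha d u - gamma) + d (- beta u u) = 0, and similarly for the other one:
[model_syzU] and [model_syzD] are the coefficients of u and d in the combination of
both relations with coefficients a and b.  The two simplified forms below show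
that each involves only two positions, through a product of weights. *)
Definition model_syzU (a b : V) : V := fun n =>
  model_u (model_d a) n - cst alpha * model_d (model_u a) n - cst gamma * a n
  + model_d (model_d b) n.
Definition model_syzD (a b : V) : V := fun n =>
  - (cst beta * model_u (model_u a) n) -
    (cst alpha * model_u (model_d b) n + cst beta * model_d (model_u b) n + cst gamma * b n).

Lemma model_syzUE a b n :
  model_syzU a b n = cst beta * wt (n + 2) * a n + dcoef n * dcoef (n + 1) * b (n + 2).
Proof.
rewrite /model_syzU model_ud model_du (weight_rec alpha gamma beta_neq0 n) /model_d -!addrA.
have -> : n + (1 + 1) = n + 2 by lia.
ring.
Qed.

Lemma model_syzDE a b n :
  model_syzD a b n = - (cst beta * ucoef n * ucoef (n - 1) * a (n - 2)) - wt (n - 1) * b n.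
Proof.
rewrite /model_syzD model_ud model_du (weight_rec alpha gamma beta_neq0 (n - 1)) /model_u.
have -> : n - 1 + 1 = n by lia.
have -> : n - 1 + 2 = n + 1 by lia.
have -> : n - 1 - 1 = n - 2 by lia.
ring.
Qed.

Lemma wdeg_ucoef n j r : wdeg (n - `|(j - 1)%R|%:Z) r -> wdeg (n + 1 - `|j|%:Z) (ucoef j * r).
Proof.
move=> hr; case: (lerP 1 j) => h.
  by rewrite ucoef_pos // mul1r; apply: wdegW hr; lia.
rewrite ucoef_neg; last lia.
have -> : n + 1 - `|j|%:Z = n - `|(j - 1)%R|%:Z + 2 by lia.
by apply: wdeg_affine => //; apply: weight_affine.
Qed.

Lemma wdeg_dcoef n j r : wdeg (n - `|(j + 1)%R|%:Z) r -> wdeg (n + 1 - `|j|%:Z) (dcoef j * r).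
Proof.
move=> hr; case: (ltrP j 0) => h.
  by rewrite dcoef_neg // mul1r; apply: wdegW hr; lia.
rewrite dcoef_pos //.
have -> : n + 1 - `|j|%:Z = n - `|(j + 1)%R|%:Z + 2 by lia.
by apply: wdeg_affine => //; apply: weight_affine.
Qed.

Lemma model_fil_u n w : model_fil n w -> model_fil (n + 1) (model_u w).
Proof. by move=> hw j; apply: wdeg_ucoef. Qed.
Lemma model_fil_d n w : model_fil n w -> model_fil (n + 1) (model_d w).
Proof. by move=> hw j; apply: wdeg_dcoef. Qed.

(** The equation at position n links p (n - 1) and q (n + 1) only.  If n > 0 it
expresses p by q, and if n < 0 it expresses q by p, one coefficient being 1; at
n = 0 it reads x p (-1) + y q 1 = 0, so that p (-1) and q 1 are given by a common
cofactor. *)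
Lemma model_exact1 n p q : model_fil n p -> model_fil n q ->
  (forall j, model_u p j + model_d q j = 0) ->
  exists a b, [/\ model_fil (n - 2) a, model_fil (n - 2) b &
    forall j, p j = model_syzU a b j /\ q j = model_syzD a b j].
Proof.
move=> hp hq e.
have [|s [ps qs]] := @vxy_coprime _ (p (-1)) (q 1).
  by have := e 0; rewrite /model_u /model_d ucoef_neg // dcoef_pos // weight0 add0r weight1.
(* The unknown a (n - 1) carries the equations at n > 0, b (n + 1) those at
   n < 0, and b 1 is the cofactor s of the equation at 0. *)
exists (fun m => if 0 <= m then - (cst beta^-1 * q (m + 2)) else 0).
exists (fun m => if m <= 0 then p (m - 2) else if m == 1 then s else 0).
have bK r : cst beta * (cst beta^-1 * r) = r.
  by rewrite mulrA -!polyCM divff // mul1r.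
split=> [j|j|j].
- case: ifP => h; last exact: wdeg0.
  by apply/wdegN/wdegZ; apply: wdegW (hq _); lia.
- case: ifP => h; first by apply: wdegW (hp _); lia.
  case: eqP => [->|_]; last exact: wdeg0.
  have := hp (-1); rewrite ps => /wdeg_y; apply: wdegW; lia.
rewrite model_syzUE model_syzDE; split.
- case: (ltrP j (-1)) => h1.
    repeat (case: ifP => ?; try lia).
    rewrite !dcoef_neg; [|lia..]; rewrite mulr0 add0r !mul1r; congr p; lia.
  case: (ltrP j 0) => h0.
    have -> : j = -1 by lia.
    by rewrite /= mulr0 add0r dcoef_neg // dcoef_pos // mul1r weight1.
  repeat (case: ifP => ?; try lia).
  rewrite mulr0 addr0; have pE : p j = - (wt (j + 2) * q (j + 2)).
    apply/eqP; have := e (j + 1); rewrite /model_u /model_d ucoef_pos ?mul1r; last lia.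
    rewrite dcoef_pos; last lia.
    have -> : j + 1 - 1 = j by lia.
    have -> : j + 1 + 1 = j + 2 by lia.
    by move/eqP; rewrite addr_eq0.
  by rewrite pE -{1}[q (j + 2)]bK; ring.
- case: (ltrP j 1) => h1.
    repeat (case: ifP => ?; try lia).
    rewrite mulr0 oppr0 add0r; apply/eqP.
    have := e (j - 1); rewrite /model_u /model_d dcoef_neg ?mul1r; last lia.
    rewrite ucoef_neg; last lia.
    have -> : j - 1 + 1 = j by lia.
    have -> : j - 1 - 1 = j - 2 by lia.
    by move/eqP; rewrite addrC addr_eq0.
  case: (ltrP j 2) => h0.
    have -> : j = 1 by lia.
    by rewrite /= mulr0 oppr0 add0r qs weight0.
  repeat (case: ifP => ?; try lia).
  rewrite !ucoef_pos; [|lia..]; rewrite mulr0 subr0 !mulr1 mulrN opprK bK.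
  congr q; lia.
Qed.

(** At each position one of the two unknowns determines the other, and the weights
that occur can be cancelled. *)
Lemma model_exact2 n a b : model_fil n a -> model_fil n b ->
  (forall j, model_syzU a b j = 0) -> (forall j, model_syzD a b j = 0) ->
  exists c, model_fil (n - 1) c /\
    forall j, a j = model_d c j /\ b j = - (cst beta * model_u c j).
Proof.
move=> ha hb e1 e2.
have bK r : cst beta * (cst beta^-1 * r) = r.
  by rewrite mulrA -!polyCM divff // mul1r.
have bVK r : cst beta^-1 * (cst beta * r) = r.
  by rewrite mulrA -!polyCM mulVf // mul1r.
have wI j (r s : R) : wt j * r = wt j * s -> r = s.
  by apply: mulfI; apply: weight_neq0.
exists (fun m => if 1 <= m then - (cst beta^-1 * b (m + 1)) else a (m - 1)).
split=> [j|j].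
  case: ifP => h; last by apply: wdegW (ha _); lia.
  by apply/wdegN/wdegZ; apply: wdegW (hb _); lia.
rewrite /model_u /model_d; split.
- case: ifP => h; last first.
    by rewrite dcoef_neg ?mul1r; [congr a; lia|lia].
  apply: (wI (j + 2)); have := e1 j; rewrite model_syzUE !dcoef_pos; [|lia..].
  have -> : j + 1 + 1 = j + 2 by lia.
  move/eqP; rewrite addr_eq0 => /eqP e; rewrite -[LHS]bVK [cst beta * _]mulrA e; ring.
- case: ifP => h.
    rewrite ucoef_pos; last lia.
    by rewrite mul1r mulrN opprK bK; congr b; lia.
  apply: (wI (j - 1)); have := e2 j; rewrite model_syzDE.
  rewrite (@ucoef_neg (j - 1)); last lia.
  have -> : j - 1 - 1 = j - 2 by lia.
  by move/eqP; rewrite subr_eq0 => /eqP <-; ring.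
Qed.

Lemma model_exact3 c : (forall j, model_u c j = 0) -> forall j, c j = 0.
Proof.
move=> e j; have /eqP := e (j + 1); rewrite /model_u mulf_eq0 (negPf (ucoef_neq0 _)) /=.
have -> : j + 1 - 1 = j by lia.
by move/eqP.
Qed.

End Model.

(** * The representation of the down-up algebra on the model *)

Section Endomorphisms.
Variable k : fieldType.
Local Notation X := int.
Local Notation R := {poly {poly k}}.
Local Notation cst c := (c%:P%:P : R).

(** Linearity over k[x, y], acting on values, in a single equation. *)
Definition is_endo (f : (X -> R) -> (X -> R)) := forall (r : R) v w,
  f (fun n => r * v n + w n) = (fun n => r * f v n + f w n).

Record endo := Endo { endo_fun :> (X -> R) -> (X -> R); endoP : is_endo endo_fun }.

HB.instance Definition _ := gen_eqMixin endo.
HB.instance Definition _ := gen_choiceMixin endo.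

Lemma endo_ext (f g : endo) : (forall v n, f v n = g v n) -> f = g.
Proof.
case: f g => [f fP] [g gP] /= fg.
have e : f = g by apply: funext => v; apply: funext => n.
by case: g / e gP fg => gP _; congr Endo; exact: Prop_irrelevance.
Qed.

Lemma endoD (f : endo) v w : f (fun n => v n + w n) = (fun n => f v n + f w n).
Proof.
have e : (fun n => v n + w n) = (fun n => 1 * v n + w n).
  by apply: funext => n; rewrite mul1r.
by rewrite e endoP; apply: funext => n; rewrite mul1r.
Qed.

Lemma endoZ (f : endo) r v : f (fun n => r * v n) = (fun n => r * f v n).
Proof.
have f0 : f (fun=> 0) = (fun=> 0).
  have := endoP f (-1) (fun=> 0) (fun=> 0).
  have -> : (fun _ : X => -1 * (0 : R) + 0) = (fun=> 0).
    by apply: funext => n; rewrite mulr0 addr0.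
  by move=> ->; apply: funext => n; rewrite mulN1r addNr.
have e : (fun n => r * v n) = (fun n => r * v n + 0).
  by apply: funext => n; rewrite addr0.
by rewrite e endoP f0; apply: funext => n; rewrite addr0.
Qed.

Fact endo_zero_subproof : is_endo (fun _ _ => 0).
Proof. by move=> r v w; apply: funext => n; rewrite mulr0 addr0. Qed.
Definition endo_zero := Endo endo_zero_subproof.

Fact endo_opp_subproof (f : endo) : is_endo (fun v n => - f v n).
Proof. by move=> r v w; apply: funext => n; rewrite endoP mulrN opprD. Qed.
Definition endo_opp f := Endo (endo_opp_subproof f).

Fact endo_add_subproof (f g : endo) : is_endo (fun v n => f v n + g v n).
Proof. by move=> r v w; apply: funext => n; rewrite !endoP mulrDr addrACA. Qed.
Definition endo_add f g := Endo (endo_add_subproof f g).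

Fact endo_addA : associative endo_add.
Proof. by move=> f g h; apply: endo_ext => v n /=; rewrite addrA. Qed.
Fact endo_addC : commutative endo_add.
Proof. by move=> f g; apply: endo_ext => v n /=; rewrite addrC. Qed.
Fact endo_add0 : left_id endo_zero endo_add.
Proof. by move=> f; apply: endo_ext => v n /=; rewrite add0r. Qed.
Fact endo_addN : left_inverse endo_zero endo_opp endo_add.
Proof. by move=> f; apply: endo_ext => v n /=; rewrite addNr. Qed.
HB.instance Definition _ :=
  GRing.isZmodule.Build endo endo_addA endo_addC endo_add0 endo_addN.

Fact endo_one_subproof : is_endo id. Proof. by []. Qed.
Definition endo_one := Endo endo_one_subproof.

Fact endo_mul_subproof (f g : endo) : is_endo (g \o f).
Proof. by move=> r v w /=; rewrite !endoP. Qed.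
(** The product is composition in the reverse order, so that the down-up algebra,
whose converse acts on the left, maps to this algebra without passing through
converses. *)
Definition endo_mul f g := Endo (endo_mul_subproof f g).

Fact endo_mulA : associative endo_mul.
Proof. by move=> f g h; apply: endo_ext. Qed.
Fact endo_mul1 : left_id endo_one endo_mul.
Proof. by move=> f; apply: endo_ext. Qed.
Fact endo_mulr1 : right_id endo_one endo_mul.
Proof. by move=> f; apply: endo_ext. Qed.
Fact endo_mulDl : left_distributive endo_mul endo_add.
Proof.
move=> f g h; apply: endo_ext => v n /=.
by rewrite -[RHS](congr1 (@^~ n) (endoD h _ _)).
Qed.
Fact endo_mulDr : right_distributive endo_mul endo_add.
Proof. by move=> f g h; apply: endo_ext. Qed.
Fact endo_one_neq0 : endo_one != endo_zero.
Proof.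
apply/eqP => /(congr1 (fun f : endo => f (fun=> 1) 0)) /= /eqP.
by rewrite oner_eq0.
Qed.
HB.instance Definition _ := GRing.Zmodule_isNzRing.Build endo
  endo_mulA endo_mul1 endo_mulr1 endo_mulDl endo_mulDr endo_one_neq0.

Fact endo_scale_subproof c (f : endo) : is_endo (fun v n => cst c * f v n).
Proof.
by move=> r v w; apply: funext => n; rewrite endoP mulrDr [cst c * (r * _)]mulrCA.
Qed.
Definition endo_scale c f := Endo (endo_scale_subproof c f).

Fact endo_scaleA a b f : endo_scale a (endo_scale b f) = endo_scale (a * b) f.
Proof. by apply: endo_ext => v n /=; rewrite mulrA -!polyCM. Qed.
Fact endo_scale1 : left_id 1 endo_scale.
Proof. by move=> f; apply: endo_ext => v n /=; rewrite mul1r. Qed.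
Fact endo_scaleDr : right_distributive endo_scale +%R.
Proof. by move=> a f g; apply: endo_ext => v n /=; rewrite mulrDr. Qed.
Fact endo_scaleDl f a b : endo_scale (a + b) f = endo_scale a f + endo_scale b f.
Proof. by apply: endo_ext => v n /=; rewrite !polyCD mulrDl. Qed.
HB.instance Definition _ := GRing.Zmodule_isLmodule.Build k endo
  endo_scaleA endo_scale1 endo_scaleDr endo_scaleDl.

Fact endo_scaleAl (c : k) (f g : endo) : c *: (f * g) = (c *: f) * g.
Proof.
by apply: endo_ext => v n /=; rewrite -[RHS](congr1 (@^~ n) (esym (endoZ g _ _))).
Qed.
HB.instance Definition _ := GRing.Lmodule_isLalgebra.Build k endo endo_scaleAl.

Fact endo_scaleAr (c : k) (f g : endo) : c *: (f * g) = f * (c *: g).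
Proof. by apply: endo_ext. Qed.
HB.instance Definition _ := GRing.Lalgebra_isAlgebra.Build k endo endo_scaleAr.

End Endomorphisms.

Section Representation.
Variables (k : fieldType) (alpha beta gamma : k).
Hypothesis beta_neq0 : beta != 0.
Local Notation R := {poly {poly k}}.
Local Notation cst c := (c%:P%:P : R).
Local Notation S := (downup alpha beta gamma).
Local Notation opU := (model_u alpha beta gamma).
Local Notation opD := (model_d alpha beta gamma).

Fact opU_subproof : is_endo opU.
Proof. by move=> r v w; apply: funext => n; rewrite /model_u mulrDr mulrCA. Qed.
Fact opD_subproof : is_endo opD.
Proof. by move=> r v w; apply: funext => n; rewrite /model_d mulrDr mulrCA. Qed.

(** phi a is the image of [delta0] under the action of a. *)
Lemma downup_model : exists phi : S -> int -> R,
  [/\ forall a b n, phi (a + b) n = phi a n + phi b n,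
      forall c a n, phi (c *: a) n = cst c * phi a n,
      phi 1 = delta0 k,
      forall a, phi (a * downupU alpha beta gamma) = opU (phi a) &
      forall a, phi (a * downupD alpha beta gamma) = opD (phi a)].
Proof.
have [||f [fU fD]] := @downup_universal k alpha beta gamma _
    (Endo opU_subproof) (Endo opD_subproof).
- by apply: endo_ext => v n; rewrite expr2; exact: model_uud.
- by apply: endo_ext => v n; rewrite expr2; exact: model_udd.
exists (fun a => f a (delta0 k)); split=> [a b n|c a n||a|a].
- by rewrite raddfD.
- by rewrite linearZ.
- by rewrite rmorph1.
- by rewrite (etrans (rmorphM f _ _) (congr1 (fun g => f a * g) fU)).
- by rewrite (etrans (rmorphM f _ _) (congr1 (fun g => f a * g) fD)).
Qed.

(** Words span the free algebra, and a word is built from the empty one by adding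
letters on its right. *)
Lemma downup_ind (P : S -> Prop) :
  (forall a b, P a -> P b -> P (a + b)) -> (forall c a, P a -> P (c *: a)) ->
  P 1 -> (forall a, P a -> P (a * downupU alpha beta gamma)) ->
  (forall a, P a -> P (a * downupD alpha beta gamma)) -> forall a, P a.
Proof.
move=> PD PZ P1 PU PD' a; have [z ->] := quot_pi_onto a.
pose pi : {lrmorphism free2 k -> S} := quot_pi (@downup_proper k alpha beta gamma).
have piZ c m : pi << c *g m >> = c *: pi (<< m >> : free2 k).
  rewrite -linearZ; congr (pi _).
  have := @mul_malgC {fmonom bool} k c << m >>.
  by rewrite malgM_def fgmulUU mulr1 mul1m.
have pi1 : pi << FMonom [::] >> = 1.
  rewrite -(rmorph1 pi); congr (pi << _ >>).
  by apply/val_inj; rewrite /= fm1.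
have piS s b : pi << FMonom (rcons s b) >> =
    pi << FMonom s >> * pi (<< fmu b >> : free2 k).
  rewrite -rmorphM; congr (pi _).
  have := @fgmulUU {fmonom bool} k 1 1 (FMonom s) (fmu b).
  rewrite mulr1 => mE; apply: etrans (esym mE); congr << _ >>.
  by apply/val_inj; rewrite /= fmM fmU /= cats1.
have Pm c m : P (pi << c *g m >>).
  apply: (eq_ind_r P _ (piZ c m)); apply: PZ.
  case: m; elim/last_ind=> [|s b IH]; first exact: (eq_ind_r P P1 pi1).
  by apply: (eq_ind_r P _ (piS s b)); case: b; [apply: PU|apply: PD'].
rewrite [z]monalgE; apply: (eq_ind_r P _ (raddf_sum pi _ _ _)).
elim/big_ind: _ => [|//|m _]; last exact: Pm.
by rewrite -(scale0r 1); apply: PZ.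
Qed.
End Representation.

(** * Maps out of free modules *)

Section LinearCombinations.
Variables (C : pzRingType) (M : lmodType C) (s : nat) (g : 'I_s -> M).

Definition lincomb (v : 'rV[C]_s) : M := \sum_i v 0 i *: g i.

Fact lincomb_is_linear : linear lincomb.
Proof.
move=> a v w; rewrite /lincomb scaler_sumr -big_split; apply: eq_bigr => i _ /=.
by rewrite !mxE scalerDl scalerA.
Qed.
HB.instance Definition _ :=
  GRing.isLinear.Build C 'rV[C]_s M *:%R lincomb lincomb_is_linear.

Lemma lincomb_delta i : lincomb (delta_mx 0 i) = g i.
Proof.
rewrite /lincomb (bigD1 i) //= mxE !eqxx scale1r big1 ?addr0 // => j ji.
by rewrite mxE (negPf ji) scale0r.
Qed.
End LinearCombinations.

(** * Dickson's lemma *)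

Section Dickson.

Definition dickson (X : eqType) (le : X -> X -> Prop) := forall T : X -> Prop,
  exists l : seq X, (forall x, x \in l -> T x) /\
    (forall t, T t -> exists2 x, x \in l & le x t).

Lemma dickson_fin (X : finType) : dickson (@eq X).
Proof.
move=> T; exists (enum [pred x | `[< T x >]]); split=> [x|t Tt].
  by rewrite mem_enum => /asboolP.
by exists t => //; rewrite mem_enum; apply/asboolP.
Qed.

(** Take a finite basis of the projection of T, with one point (x, f x) of T above
each of its elements.  The points of T not dominated by these have a second
coordinate smaller than the maximum of f, and each of these finitely many slices
has a finite basis. *)
Lemma dickson_nat (X : eqType) (le : X -> X -> Prop) : dickson le ->
  dickson (fun p q : X * nat => le p.1 q.1 /\ (p.2 <= q.2)%N).
Proof.
move=> D T; have [l [lT Tl]] := D (fun x => exists n, T (x, n)).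
have /choice [f hf] x : exists n, x \in l -> T (x, n).
  case: (boolP (x \in l)) => [/lT [n Tn]|_]; first by exists n.
  by exists 0%N.
have /choice [h hh] n := D (fun x => T (x, n)).
pose N := (\max_(x <- l) f x)%N.
exists ([seq (x, f x) | x <- l] ++ [seq (x, n) | n <- iota 0 N, x <- h n]).
split=> [p|[x n] Tx].
  rewrite mem_cat => /orP[/mapP [x xl ->]|/allpairsPdep [n [x [_ xh ->]]]].
    exact: hf.
  by have [+ _] := hh n; apply.
have [y yl ley] := Tl x (ex_intro _ n Tx).
case: (leqP (f y) n) => [fn|nf].
  by exists (y, f y) => //; rewrite mem_cat; apply/orP; left; apply/mapP; exists y.
have [_ /(_ x Tx) [z zh lez]] := hh n.
exists (z, n) => //; rewrite mem_cat; apply/orP; right.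
apply/allpairsPdep; exists n, z; split=> //.
rewrite mem_iota add0n /=; apply: leq_trans nf _.
exact: (leq_bigmax_seq (F := f)).
Qed.
End Dickson.

Section LexicographicCode.
Lemma lex_code_lt M p q p' q' : (q < M)%N ->
  (p < p')%N \/ p = p' /\ (q < q')%N -> (p * M + q < p' * M + q')%N.
Proof.
move=> qM [pp|[-> qq]]; last by rewrite ltn_add2l.
have := leq_mul pp (leqnn M); rewrite mulSn; lia.
Qed.
End LexicographicCode.

(** * Splitting a finite free resolution of a projective module *)

Section Resolutions.
Variable C : pzRingType.

Lemma free_lift (M N : lmodType C) s (f : {linear M -> N}) (h : {linear 'rV[C]_s -> N}) :
  (forall v, exists x, f x = h v) ->
  exists h' : {linear 'rV[C]_s -> M}, forall v, f (h' v) = h v.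
Proof.
move=> fh; have /fin_all_exists [g hg] i := fh (delta_mx 0 i).
exists (lincomb g) => v; rewrite linear_sum [in RHS](row_sum_delta v) linear_sum.
by apply: eq_bigr => i _; rewrite !linearZ /= hg.
Qed.

(** Projectivity yields a contracting homotopy h of the complex
0 -> F4 -> ... -> F0 -> P -> 0 with differential f.  The map f + h from
P + F1 + F3 to F0 + F2 + F4 is then an isomorphism: its composite with the map
f + h in the other direction is 1 + h h, which is unipotent because h h raises
the degree by 2.  Its inverse is written out by solving a triangular system. *)
Lemma resolution_stably_free (P : lmodType C) s0 s1 s2 s3 s4
    (f0 : {linear 'rV[C]_s0 -> P}) (f1 : {linear 'rV[C]_s1 -> 'rV[C]_s0})
    (f2 : {linear 'rV[C]_s2 -> 'rV[C]_s1}) (f3 : {linear 'rV[C]_s3 -> 'rV[C]_s2})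
    (f4 : {linear 'rV[C]_s4 -> 'rV[C]_s3}) :
  (forall x, exists v, f0 v = x) ->
  (forall v, f0 v = 0 <-> exists w, f1 w = v) ->
  (forall v, f1 v = 0 <-> exists w, f2 w = v) ->
  (forall v, f2 v = 0 <-> exists w, f3 w = v) ->
  (forall v, f3 v = 0 <-> exists w, f4 w = v) ->
  (forall v, f4 v = 0 -> v = 0) ->
  projective P -> stably_free P.
Proof.
move=> f0s ex0 ex1 ex2 ex3 f4i projP.
have f01 v : f0 (f1 v) = 0 by apply/ex0; exists v.
have f12 v : f1 (f2 v) = 0 by apply/ex1; exists v.
have f23 v : f2 (f3 v) = 0 by apply/ex2; exists v.
have f34 v : f3 (f4 v) = 0 by apply/ex3; exists v.
have [h0 E0] := projP _ _ f0 idfun f0s.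
have [|h1 E1] := @free_lift _ _ _ f1 (idfun \- (h0 \o f0)).
  by move=> v; apply/ex0; rewrite /= linearB /= E0 subrr.
have [|h2 E2] := @free_lift _ _ _ f2 (idfun \- (h1 \o f1)).
  by move=> v; apply/ex1; rewrite /= linearB /= E1 /= f01 linear0 subr0 subrr.
have [|h3 E3] := @free_lift _ _ _ f3 (idfun \- (h2 \o f2)).
  by move=> v; apply/ex2; rewrite /= linearB /= E2 /= f12 linear0 subr0 subrr.
have [|h4 E4] := @free_lift _ _ _ f4 (idfun \- (h3 \o f3)).
  by move=> v; apply/ex3; rewrite /= linearB /= E3 /= f23 linear0 subr0 subrr.
rewrite /= in E0 E1 E2 E3 E4.
have E5 v : h4 (f4 v) = v.
  apply/eqP; rewrite -subr_eq0; apply/eqP/f4i.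
  by rewrite linearB /= E4 f34 linear0 subr0 subrr.
pose Phi (x : P * 'rV[C]_(s1 + s3)) : 'rV[C]_(s0 + (s2 + s4)) :=
  row_mx (h0 x.1 + f1 (lsubmx x.2))
    (row_mx (h2 (lsubmx x.2) + f3 (rsubmx x.2)) (h4 (rsubmx x.2))).
have PhiL : linear Phi.
  move=> a x y; rewrite /Phi /= !linearD !linearZ /= !scale_row_mx !add_row_mx.
  by congr (row_mx _ (row_mx _ _)); rewrite // scalerDr addrACA.
pose PhiLin := GRing.isLinear.Build C _ _ *:%R Phi PhiL.
pose F : {linear (P * 'rV[C]_(s1 + s3))%type -> 'rV[C]_(s0 + (s2 + s4))} :=
  HB.pack Phi PhiLin.
exists (s1 + s3)%N, (s0 + (s2 + s4))%N, F.
pose Psi (w : 'rV[C]_(s0 + (s2 + s4))) : P * 'rV[C]_(s1 + s3) :=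
  let w0 := lsubmx w in
  let w2 := lsubmx (rsubmx w) - h2 (h1 w0) in
  let w4 := rsubmx (rsubmx w) - h4 (h3 w2) in
  (f0 w0, row_mx (h1 w0 + f2 w2) (h3 w2 + f4 w4)).
have PsiK : cancel Psi F.
  have c0 w0 w2 : h0 (f0 w0) + f1 (h1 w0 + f2 w2) = w0.
    by rewrite linearD /= f12 addr0 E1 addrC subrK.
  have c2 w0 w2 w4 : h2 (h1 w0 + f2 w2) + f3 (h3 w2 + f4 w4) = h2 (h1 w0) + w2.
    by rewrite !linearD /= f34 addr0 E3 -addrA [h2 (f2 _) + _]addrC subrK.
  have c4 w2 w4 : h4 (h3 w2 + f4 w4) = h4 (h3 w2) + w4 by rewrite linearD /= E5.
  move=> w; rewrite /F /= /Phi /Psi /= !row_mxKl !row_mxKr c0 c2 c4.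
  by rewrite ![_ + (_ - _)]addrC !subrK !hsubmxK.
have Finj : injective F.
  apply: raddf_inj => -[p v]; rewrite /F /= /Phi /= -row_mx0 => /eq_row_mx [e0].
  rewrite -row_mx0 => /eq_row_mx [e2 e4].
  have p0 : p = 0.
    by have := congr1 f0 e0; rewrite linearD /= E0 f01 addr0 linear0.
  have fv1 : f1 (lsubmx v) = 0 by move: e0; rewrite p0 linear0 add0r.
  have v1 : lsubmx v = 0.
    by have := congr1 f2 e2; rewrite linearD /= E2 f23 fv1 (linear0 h1) (linear0 f2) subr0 addr0.
  have fv3 : f3 (rsubmx v) = 0 by move: e2; rewrite v1 linear0 add0r.
  have v3 : rsubmx v = 0.
    by have := congr1 f4 e4; rewrite E4 fv3 (linear0 h3) (linear0 f4) subr0.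
  by rewrite p0 -[v]hsubmxK v1 v3 row_mx0.
by exists Psi => //; apply: inj_can_sym.
Qed.
End Resolutions.

(** * Normal form and exactness of the converse of a down-up algebra *)

Section NormalForm.
Variables (k : fieldType) (alpha beta gamma : k).
Hypothesis beta_neq0 : beta != 0.
Local Notation R := {poly {poly k}}.
Local Notation cst c := (c%:P%:P : R).
Local Notation opU := (model_u alpha beta gamma).
Local Notation opD := (model_d alpha beta gamma).

Variables (C : pzRingType) (u d : C) (kc : {rmorphism k -> C}).

(** C stands for the converse of the down-up algebra and phi for its map to the
model; the theory below uses nothing else about them, which keeps the quotient
construction out of the proofs. *)
Record is_downup (phi : C -> int -> R) : Prop := IsDownup {
  kc_central : forall c a, kc c * a = a * kc c;
  relC_uud : u * u * d = kc alpha * (u * d * u) + kc beta * (d * u * u) + kc gamma * u;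
  relC_udd : u * d * d = kc alpha * (d * u * d) + kc beta * (d * d * u) + kc gamma * d;
  phi_add : forall a b n, phi (a + b) n = phi a n + phi b n;
  phi_scale : forall c a n, phi (kc c * a) n = cst c * phi a n;
  phi_one : phi 1 = delta0 k;
  phi_u : forall a, phi (u * a) = opU (phi a);
  phi_d : forall a, phi (d * a) = opD (phi a);
  downupC_ind : forall P : C -> Prop,
    (forall a b, P a -> P b -> P (a + b)) -> (forall c a, P a -> P (kc c * a)) ->
    P 1 -> (forall a, P a -> P (u * a)) -> (forall a, P a -> P (d * a)) ->
    forall a, P a }.

Section Modules.
Variables (M : lmodType C).

(** The coefficients of u and d in the combination of the two relations of C with
coefficients a and b. *)
Definition syzygyU (a b : M) : M :=
  (u * d - kc alpha * (d * u) - kc gamma) *: a + (d * d) *: b.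
Definition syzygyD (a b : M) : M :=
  - ((kc beta * (u * u)) *: a)
  - (kc alpha * (u * d) + kc beta * (d * u) + kc gamma) *: b.

Lemma syzygyUE a b : syzygyU a b =
  u *: (d *: a) - kc alpha *: (d *: (u *: a)) - kc gamma *: a + d *: (d *: b).
Proof. by rewrite /syzygyU !scalerBl !scalerA mulrA. Qed.

Lemma syzygyDE a b : syzygyD a b =
  - (kc beta *: (u *: (u *: a))) -
  (kc alpha *: (u *: (d *: b)) + kc beta *: (d *: (u *: b)) + kc gamma *: b).
Proof. by rewrite /syzygyD !scalerDl !scalerA !mulrA. Qed.

(** The filtered module is the union of the F n, which may be a proper subset of
M; this allows to treat kernels without leaving the ambient free module. *)
Record filtration (F : int -> M -> Prop) : Prop := Filtration {
  fil_sub : forall n x y, F n x -> F n y -> F n (x - y);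
  fil_scale : forall n c x, F n x -> F n (kc c *: x);
  fil_zero : forall n, F n 0;
  fil_mono : forall m n x, m <= n -> F m x -> F n x;
  fil_u : forall n x, F n x -> F (n + 1) (u *: x);
  fil_d : forall n x, F n x -> F (n + 1) (d *: x);
  fil_neg : forall n x, n < 0 -> F n x -> x = 0 }.

(** Exactness of c |-> (d c, - beta u c), (a, b) |-> (syzygyU a b, syzygyD a b) and
(p, q) |-> u p + d q, numbered from the right.  The shifts of the filtration are
the degrees of the entries of these maps.  Spot 0 is not a surjectivity statement:
it says that F n / (u F (n - 1) + d F (n - 1)) injects into the same quotient for
n + 1. *)
Definition koszul_exact0 (F : int -> M -> Prop) := forall n p q,
  F n p -> F n q -> F n (u *: p + d *: q) ->
  exists p' q', [/\ F (n - 1) p', F (n - 1) q' & u *: p + d *: q = u *: p' + d *: q'].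
Definition koszul_exact1 (F : int -> M -> Prop) := forall n p q,
  F n p -> F n q -> u *: p + d *: q = 0 ->
  exists a b, [/\ F (n - 2) a, F (n - 2) b, p = syzygyU a b & q = syzygyD a b].
Definition koszul_exact2 (F : int -> M -> Prop) := forall n a b,
  F n a -> F n b -> syzygyU a b = 0 -> syzygyD a b = 0 ->
  exists c, [/\ F (n - 1) c, a = d *: c & b = - (kc beta * u) *: c].
Definition koszul_exact3 (F : int -> M -> Prop) := forall n c,
  F n c -> u *: c = 0 -> d *: c = 0 -> c = 0.
End Modules.

Variable phi : C -> int -> R.
Hypothesis HC : is_downup phi.

Lemma phi_zero n : phi 0 n = 0.
Proof. by have := phi_scale HC 0 0 n; rewrite rmorph0 mul0r !polyC0 mul0r. Qed.

Lemma phi_opp a n : phi (- a) n = - phi a n.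
Proof. by apply/eqP; rewrite -addr_eq0 -(phi_add HC) addNr phi_zero. Qed.

Lemma phi_sub a b n : phi (a - b) n = phi a n - phi b n.
Proof. by rewrite (phi_add HC) phi_opp. Qed.

Lemma phi_kc c n : phi (kc c) n = cst c * delta0 k n.
Proof. by rewrite -[kc c]mulr1 (phi_scale HC) (phi_one HC). Qed.

Lemma phi_uZ (a : C^o) : phi (u *: a) = opU (phi a). Proof. exact: phi_u. Qed.
Lemma phi_dZ (a : C^o) : phi (d *: a) = opD (phi a). Proof. exact: phi_d. Qed.
Lemma phi_kZ c (a : C^o) n : phi (kc c *: a) n = cst c * phi a n.
Proof. exact: phi_scale. Qed.

Lemma phi_syzygyU (a b : C^o) n :
  phi (syzygyU a b) n = model_syzU alpha beta gamma (phi a) (phi b) n.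
Proof.
by rewrite syzygyUE (phi_add HC) !phi_sub !phi_kZ !(phi_uZ, phi_dZ).
Qed.

Lemma phi_syzygyD (a b : C^o) n :
  phi (syzygyD a b) n = model_syzD alpha beta gamma (phi a) (phi b) n.
Proof.
by rewrite syzygyDE phi_sub phi_opp !(phi_add HC) !phi_kZ !(phi_uZ, phi_dZ).
Qed.

Section Koszul.
Variable M : lmodType C.
Implicit Types a b c : M.

Lemma u_kc l a : u *: (kc l *: a) = kc l *: (u *: a).
Proof. by rewrite !scalerA (kc_central HC). Qed.

Lemma d_kc l a : d *: (kc l *: a) = kc l *: (d *: a).
Proof. by rewrite !scalerA (kc_central HC). Qed.

Lemma rel_uud a : u *: (u *: (d *: a)) =
  kc alpha *: (u *: (d *: (u *: a))) + kc beta *: (d *: (u *: (u *: a))) + kc gamma *: (u *: a).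
Proof. by rewrite !scalerA (relC_uud HC) !scalerDl !mulrA. Qed.

Lemma rel_udd a : u *: (d *: (d *: a)) =
  kc alpha *: (d *: (u *: (d *: a))) + kc beta *: (d *: (d *: (u *: a))) + kc gamma *: (d *: a).
Proof. by rewrite !scalerA (relC_udd HC) !scalerDl !mulrA. Qed.

Lemma syzygy_relation a b : u *: syzygyU a b + d *: syzygyD a b = 0.
Proof.
rewrite syzygyUE syzygyDE !(scalerDr, scalerBr, scalerN) !(u_kc, d_kc).
rewrite rel_uud rel_udd.
set P := kc alpha *: _; set Q := kc beta *: _; set S := kc gamma *: _.
have -> : P + Q + S - P - S = Q by rewrite -addrA -opprD [P + Q]addrC -[Q + P + S]addrA addrK.
by rewrite -opprD subrr.
Qed.

(** With r1 and r2 the two relators of C, this is the identity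
r1 d - beta r2 u = u r2 - beta d r1 of the free algebra. *)
Lemma syzygy_of_syzygy c : syzygyU (d *: c) (- (kc beta * u) *: c) = 0 /\
  syzygyD (d *: c) (- (kc beta * u) *: c) = 0.
Proof.
rewrite syzygyUE syzygyDE scaleNr -scalerA !(scalerDr, scalerBr, scalerN) !(u_kc, d_kc).
split.
  rewrite rel_udd.
  set P := kc alpha *: _; set Q := kc beta *: _; set S := kc gamma *: _.
  have -> : P + Q + S - P - S = Q by rewrite -addrA -opprD [P + Q]addrC -[Q + P + S]addrA addrK.
  by rewrite subrr.
have kk l m a : kc l *: (kc m *: a) = kc m *: (kc l *: a).
  by rewrite !scalerA (kc_central HC).
by rewrite rel_uud !scalerDr -!opprD (kk beta alpha) (kk beta gamma) subrr oppr0.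
Qed.
End Koszul.

Definition cfil (n : int) (a : C) := model_fil n (phi a).

(** Used only until phi is known to be injective; after that, [cfil] is read off
the model. *)
Fixpoint word_span (n : nat) (a : C) : Prop :=
  match n with
  | 0 => exists c, a = kc c
  | m.+1 => exists c b b', [/\ word_span m b, word_span m b' & a = kc c + u * b + d * b']
  end.

Lemma word_span0 n : word_span n 0.
Proof.
elim: n => [|n IH]; first by exists 0; rewrite rmorph0.
by exists 0, 0, 0; split=> //; rewrite rmorph0 !mulr0 !addr0.
Qed.

Lemma word_spanD n a b : word_span n a -> word_span n b -> word_span n (a + b).
Proof.
elim: n a b => [|n IH] a b /=.
  by move=> [c ->] [c' ->]; exists (c + c'); rewrite rmorphD.
move=> [c [p [q [hp hq ->]]]] [c' [p' [q' [hp' hq' ->]]]].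
exists (c + c'), (p + p'), (q + q'); split; [exact: IH|exact: IH|].
by rewrite rmorphD !mulrDr addrACA; congr (_ + _); rewrite addrACA.
Qed.

Lemma word_spanZ n c a : word_span n a -> word_span n (kc c * a).
Proof.
elim: n a => [|n IH] a /=; first by move=> [c' ->]; exists (c * c'); rewrite rmorphM.
move=> [c' [p [q [hp hq ->]]]]; exists (c * c'), (kc c * p), (kc c * q).
split; [exact: IH|exact: IH|].
by rewrite rmorphM !mulrDr; congr (_ + _ + _); rewrite !mulrA (kc_central HC).
Qed.

Lemma word_spanN n a : word_span n a -> word_span n (- a).
Proof. by move=> /(word_spanZ (-1)); rewrite rmorphN rmorph1 mulN1r. Qed.

Lemma word_span_u n a : word_span n a -> word_span n.+1 (u * a).
Proof.
move=> ha; exists 0, a, 0; split=> //; first exact: word_span0.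
by rewrite rmorph0 mulr0 add0r addr0.
Qed.

Lemma word_span_d n a : word_span n a -> word_span n.+1 (d * a).
Proof.
move=> ha; exists 0, 0, a; split=> //; first exact: word_span0.
by rewrite rmorph0 mulr0 !add0r.
Qed.

Lemma word_spanS n a : word_span n a -> word_span n.+1 a.
Proof.
elim: n a => [|n IH] a.
  by move=> [c ->]; exists c, 0, 0; split; rewrite ?mulr0 ?addr0 //; exact: word_span0.
move=> [c [p [q [hp hq ->]]]]; exists c, p, q; split=> //; exact: IH.
Qed.

Lemma word_spanW m n a : (m <= n)%N -> word_span m a -> word_span n a.
Proof.
move=> /subnKC <-; elim: (n - m)%N => [|e IH]; first by rewrite addn0.
by move=> /IH; rewrite addnS; exact: word_spanS.
Qed.

Lemma word_span_exhaust a : exists n, word_span n a.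
Proof.
move: a; apply: (downupC_ind HC) => [a b [m ha] [n hb]|c a [n ha]||a [n ha]|a [n ha]].
- exists (maxn m n); apply: word_spanD; [apply: word_spanW ha|apply: word_spanW hb]; lia.
- by exists n; apply: word_spanZ.
- by exists 0%N, 1; rewrite rmorph1.
- by exists n.+1; apply: word_span_u.
- by exists n.+1; apply: word_span_d.
Qed.

Lemma word_span_lift (n : nat) w : model_fil n w ->
  exists2 a, word_span n a & forall j, phi a j = w j.
Proof.
elim: n w => [|n IH] w /(model_split alpha beta gamma) [p [q [hp hq e]]].
  exists (kc (w 0)`_0`_0); first by exists (w 0)`_0`_0.
  move=> j; rewrite phi_kc [w j]e /model_u /model_d.
  rewrite (model_fil_lt0 _ hp) ?(model_fil_lt0 _ hq) ?mulr0; [|lia..].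
  by rewrite !addr0.
have [|a ha ea] := IH p; first by apply: model_filW hp; lia.
have [|b hb eb] := IH q; first by apply: model_filW hq; lia.
exists (kc (w 0)`_0`_0 + u * a + d * b).
  by exists (w 0)`_0`_0, a, b.
move=> j; rewrite !(phi_add HC) phi_kc (phi_u HC) (phi_d HC) [w j]e.
by rewrite /model_u /model_d ea eb.
Qed.

Lemma phi_word_span n a : word_span n a -> cfil n%:Z a.
Proof.
elim: n a => [|n IH] a /=.
  move=> [c ->] j; rewrite phi_kc /delta0.
  case: eqP => [->|_]; last by rewrite mulr0; apply: wdeg0.
  by rewrite mulr1 => a' b h; rewrite coef_cst; case: ifP => //; lia.
move=> [c [p [q [/IH hp /IH hq ->]]]] j; rewrite !(phi_add HC) phi_kc (phi_u HC) (phi_d HC).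
have -> : n.+1%:Z = n%:Z + 1 by lia.
apply: wdegD; last exact: model_fil_d.
apply: wdegD; last exact: model_fil_u.
rewrite /delta0; case: eqP => [->|_]; last by rewrite mulr0; apply: wdeg0.
by rewrite mulr1 => a' b h; rewrite coef_cst; case: ifP => //; lia.
Qed.

(** For n < 2 the bound n - 2 is negative and only 0 is lifted; stating all
products of length 2 at once hides this case distinction from the user. *)
Lemma word_span_lift2 (n : nat) w : model_fil (n%:Z - 2) w ->
  exists a : C^o, (forall j, phi a j = w j) /\
    [/\ word_span n (u *: (u *: a)), word_span n (u *: (d *: a)), word_span n (d *: (u *: a)),
       word_span n (d *: (d *: a)) & word_span n a].
Proof.
case: n => [|[|n]] hw; last first.
  have [|a ha ea] := @word_span_lift n w; first by apply: model_filW hw; lia.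
  exists a; split=> //.
  split.
  - exact: (word_span_u (word_span_u ha)).
  - exact: (word_span_u (word_span_d ha)).
  - exact: (word_span_d (word_span_u ha)).
  - exact: (word_span_d (word_span_d ha)).
  - exact: (word_spanS (word_spanS ha)).
all: exists 0; rewrite !scaler0; split; last by split; exact: word_span0.
all: by move=> j; rewrite phi_zero (model_fil_lt0 _ hw).
Qed.

(** The linear independence of normal forms follows from exactness of the model
at spot 1.  If u p + d q is killed by phi, then (phi p, phi q) is a combination of
the relations in the model; lifting its coefficients to C and using induction
on the length, (p, q) is the same combination in C, whence u p + d q = 0. *)
Lemma phi_inj_word_span n a : word_span n a -> (forall j, phi a j = 0) -> a = 0.
Proof.
elim: n a => [|n IH] a.
  move=> [c ->] /(_ 0); rewrite phi_kc /delta0 /= mulr1 => /eqP.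
  by rewrite !polyC_eq0 => /eqP ->; rewrite rmorph0.
move=> [c [p [q [hp hq ->]]]] e.
have e' j : cst c * delta0 k j + opU (phi p) j + opD (phi q) j = 0.
  by rewrite -(e j) !(phi_add HC) phi_kc (phi_u HC) (phi_d HC).
have c0 : c = 0.
  have := e' 0; rewrite /delta0 /= mulr1 /model_u /model_d.
  rewrite ucoef_neg // dcoef_pos // weight0 add0r weight1.
  move=> /(congr1 (fun r : R => r`_0`_0)).
  by rewrite !coefD coef_cst coef_vxM coef_vyM !coef0 !addr0.
have [||j|s [t [hs ht st]]] := @model_exact1 _ alpha beta gamma beta_neq0 n (phi p) (phi q).
- exact: phi_word_span.
- exact: phi_word_span.
- by have := e' j; rewrite c0 !polyC0 mul0r add0r.
have [s' [es [s1 s2 s3 s4 s5]]] := word_span_lift2 hs.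
have [t' [et [t1 t2 t3 t4 t5]]] := word_span_lift2 ht.
have wZ c' (b : C^o) : word_span n b -> word_span n (kc c' *: b) by exact: word_spanZ.
have wB (b b' : C^o) : word_span n b -> word_span n b' -> word_span n (b - b').
  by move=> hb /word_spanN; exact: word_spanD.
have wU : word_span n (syzygyU s' t').
  by rewrite syzygyUE; apply: word_spanD => //; apply: (wB); [apply: (wB) => //|]; exact: wZ.
have wD : word_span n (syzygyD s' t').
  rewrite syzygyDE; apply: wB; first exact/word_spanN/wZ.
  by apply: word_spanD; [apply: word_spanD|]; exact: wZ.
have ext1 x x' y y' : (forall j, x j = x' j) -> (forall j, y j = y' j) ->
    forall j, model_syzU alpha beta gamma x y j = model_syzU alpha beta gamma x' y' j.
  by move=> ex ey j; rewrite !model_syzUE // ex ey.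
have ext2 x x' y y' : (forall j, x j = x' j) -> (forall j, y j = y' j) ->
    forall j, model_syzD alpha beta gamma x y j = model_syzD alpha beta gamma x' y' j.
  by move=> ex ey j; rewrite !model_syzDE // ex ey.
have pE : p = syzygyU s' t'.
  apply/eqP; rewrite -subr_eq0; apply/eqP/IH; first exact: wB.
  by move=> j; rewrite phi_sub phi_syzygyU (ext1 _ _ _ _ es et) (st j).1 subrr.
have qE : q = syzygyD s' t'.
  apply/eqP; rewrite -subr_eq0; apply/eqP/IH; first exact: wB.
  by move=> j; rewrite phi_sub phi_syzygyD (ext2 _ _ _ _ es et) (st j).2 subrr.
by rewrite c0 rmorph0 add0r pE qE; exact: (syzygy_relation s' t').
Qed.

Lemma phi_inj a b : (forall j, phi a j = phi b j) -> a = b.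
Proof.
move=> e; apply/eqP; rewrite -subr_eq0; apply/eqP.
have [n hn] := word_span_exhaust (a - b).
by apply: (phi_inj_word_span hn) => j; rewrite phi_sub e subrr.
Qed.

Lemma phi_lift n w : model_fil n w -> exists2 a, cfil n a & forall j, phi a j = w j.
Proof.
move=> hw; have [|a _ ea] := @word_span_lift `|n|%N w; first by apply: model_filW hw; lia.
by exists a => // j; rewrite ea.
Qed.

Lemma cfil_filtration : filtration (cfil : int -> C^o -> Prop).
Proof.
split=> [n a b ha hb j|n c a ha j|n j|m n a mn|n a ha j|n a ha j|n a n0 ha].
- by rewrite phi_sub; apply: wdegB.
- by rewrite phi_kZ; apply: wdegZ.
- by rewrite phi_zero; apply: wdeg0.
- exact: model_filW.
- by rewrite phi_uZ; apply: model_fil_u.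
- by rewrite phi_dZ; apply: model_fil_d.
- by apply: phi_inj => j; rewrite (model_fil_lt0 n0 ha) phi_zero.
Qed.

Lemma cfil_exhaust a : exists n : nat, cfil n a.
Proof. by have [n hn] := word_span_exhaust a; exists n; apply: phi_word_span. Qed.

Lemma cfil_split n a : cfil n a ->
  exists c b b', [/\ cfil (n - 1) b, cfil (n - 1) b' & a = kc c + u * b + d * b'].
Proof.
move=> /(model_split alpha beta gamma) [p [q [/phi_lift [b hb eb] /phi_lift [b' hb' eb'] e]]].
exists (phi a 0)`_0`_0, b, b'; split=> //; apply: phi_inj => j.
by rewrite e !(phi_add HC) phi_kc (phi_u HC) (phi_d HC) /model_u /model_d eb eb'.
Qed.

Lemma cfil_kc c : cfil 0 (kc c).
Proof. by apply: (@phi_word_span 0); exists c. Qed.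

Lemma filM (M : lmodType C) (F : int -> M -> Prop) : filtration F ->
  forall m n a x, cfil m a -> F n x -> F (m + n) (a *: x).
Proof.
move=> HF m n a x; have addF l p q : F l p -> F l q -> F l (p + q).
  move=> hp hq; rewrite -[q]opprK; apply: fil_sub => //.
  by rewrite -[- q]add0r; apply: fil_sub => //; apply: fil_zero.
have [m0|] := ltrP m 0.
  by move=> ha _; rewrite (fil_neg cfil_filtration m0 ha) scale0r; exact: fil_zero.
case: m => [m _|//]; elim: m a => [|m IH] a /cfil_split [c [b [b' [hb hb' ->]]]] hx.
  have z := fil_neg cfil_filtration.
  rewrite (z _ _ _ hb) ?(z _ _ _ hb'); [|lia..].
  by rewrite !mulr0 !addr0 add0r; apply: fil_scale.
rewrite !scalerDl -!scalerA; have -> : m.+1%:Z + n = m%:Z + n + 1 by lia.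
have e : m.+1%:Z - 1 = m%:Z by lia.
rewrite e in hb hb'.
apply: (addF); first apply: (addF).
- by apply: (fil_mono HF _ (fil_scale HF c hx)); lia.
- exact/(fil_u HF)/IH.
- exact/(fil_d HF)/IH.
Qed.

Lemma cfil_exact0 : koszul_exact0 (cfil : int -> C^o -> Prop).
Proof.
move=> n p q hp hq h.
have [||j|p' [q' [hp' hq' e]]] := @model_exact0 _ alpha beta gamma n (phi p) (phi q) => //.
  by have := h j; rewrite (phi_add HC) phi_uZ phi_dZ.
have [a ha ea] := phi_lift hp'; have [b hb eb] := phi_lift hq'.
exists a, b; split=> //; apply: phi_inj => j.
by rewrite !(phi_add HC) !(phi_uZ, phi_dZ) e /model_u /model_d ea eb.
Qed.

Lemma cfil_exact1 : koszul_exact1 (cfil : int -> C^o -> Prop).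
Proof.
move=> n p q hp hq h.
have [||j|a [b [ha hb e]]] := @model_exact1 _ alpha beta gamma beta_neq0 n (phi p) (phi q) => //.
  by have := congr1 (fun x => phi x j) h; rewrite (phi_add HC) phi_uZ phi_dZ phi_zero.
have [a' ha' ea] := phi_lift ha; have [b' hb' eb] := phi_lift hb.
exists a', b'; split=> //; apply: phi_inj => j.
  by rewrite phi_syzygyU model_syzUE // (e j).1 model_syzUE // ea eb.
by rewrite phi_syzygyD model_syzDE // (e j).2 model_syzDE // ea eb.
Qed.

Lemma cfil_exact2 : koszul_exact2 (cfil : int -> C^o -> Prop).
Proof.
move=> n a b ha hb e1 e2.
have [||j|j|c [hc e]] := @model_exact2 _ alpha beta gamma beta_neq0 n (phi a) (phi b) => //.
- by rewrite -phi_syzygyU e1 phi_zero.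
- by rewrite -phi_syzygyD e2 phi_zero.
have [c' hc' ec] := phi_lift hc.
exists c'; split=> //; apply: phi_inj => j.
  by rewrite phi_dZ (e j).1 /model_d ec.
by rewrite scaleNr -scalerA phi_opp phi_kZ phi_uZ (e j).2 /model_u ec.
Qed.

Lemma cfil_exact3 : koszul_exact3 (cfil : int -> C^o -> Prop).
Proof.
move=> n c _ e _; apply: phi_inj => j; rewrite phi_zero.
apply: (model_exact3 (alpha := alpha) (beta := beta) (gamma := gamma) beta_neq0) => i.
by rewrite -phi_uZ e phi_zero.
Qed.

(** * Syzygies of filtered modules *)

Section FilteredModules.

Section FreeModule.
Variables (s : nat) (e : 'I_s -> nat).

Definition rfil (n : int) (v : 'rV[C]_s) := forall i, cfil (n - (e i)%:Z) (v 0 i).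

Lemma rfil_filtration : filtration rfil.
Proof.
have HF := cfil_filtration.
split=> [n v w hv hw i|n c v hv i|n i|m n v mn hv i|n v hv i|n v hv i|n v n0 hv].
- by rewrite !mxE; apply: (fil_sub HF).
- by rewrite mxE; apply: (fil_scale HF).
- by rewrite mxE; apply: (fil_zero HF).
- by apply: (fil_mono HF _ (hv i)); lia.
- by rewrite mxE addrAC; apply: (fil_u HF).
- by rewrite mxE addrAC; apply: (fil_d HF).
- by apply/rowP=> i; rewrite mxE; apply: (fil_neg HF _ (hv i)); lia.
Qed.

Lemma rfil_exhaust v : exists n : nat, rfil n v.
Proof.
have [f hf] := fin_all_exists (fun i => cfil_exhaust (v 0 i)).
exists (\max_i (f i + e i))%N => i; apply: (fil_mono cfil_filtration _ (hf i)).
by have := leq_bigmax (F := fun i => (f i + e i)%N) i; lia.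
Qed.

Lemma row_syzygyU (a b : 'rV[C]_s) i :
  syzygyU a b 0 i = syzygyU (a 0 i : C^o) (b 0 i : C^o).
Proof. by rewrite !syzygyUE !mxE. Qed.

Lemma row_syzygyD (a b : 'rV[C]_s) i :
  syzygyD a b 0 i = syzygyD (a 0 i : C^o) (b 0 i : C^o).
Proof. by rewrite !syzygyDE !mxE. Qed.

Lemma rfil_exact0 : koszul_exact0 rfil.
Proof.
move=> n p q hp hq h.
have /fin_all_exists [f hf] i : exists ab : C^o * C^o,
    [/\ cfil (n - 1 - (e i)%:Z) ab.1, cfil (n - 1 - (e i)%:Z) ab.2 &
      u * p 0 i + d * q 0 i = u * ab.1 + d * ab.2].
  have [|a [b [ha hb eab]]] := cfil_exact0 (hp i) (hq i).
    by have := h i; rewrite !mxE.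
  by exists (a, b); rewrite addrAC.
exists (\row_i (f i).1), (\row_i (f i).2); split=> [i|i|].
- by rewrite mxE; case: (hf i).
- by rewrite mxE; case: (hf i).
- by apply/rowP=> i; rewrite !mxE; case: (hf i).
Qed.

Lemma rfil_exact1 : koszul_exact1 rfil.
Proof.
move=> n p q hp hq h.
have /fin_all_exists [f hf] i : exists ab : C^o * C^o,
    [/\ cfil (n - 2 - (e i)%:Z) ab.1, cfil (n - 2 - (e i)%:Z) ab.2,
      p 0 i = syzygyU ab.1 ab.2 & q 0 i = syzygyD ab.1 ab.2].
  have [|a [b [ha hb eab eab']]] := cfil_exact1 (hp i) (hq i).
    by have /rowP/(_ i) := h; rewrite !mxE.
  by exists (a, b); rewrite addrAC.
exists (\row_i (f i).1), (\row_i (f i).2); split=> [i|i||].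
- by rewrite mxE; case: (hf i).
- by rewrite mxE; case: (hf i).
- by apply/rowP=> i; rewrite row_syzygyU !mxE; case: (hf i).
- by apply/rowP=> i; rewrite row_syzygyD !mxE; case: (hf i).
Qed.

Lemma rfil_exact2 : koszul_exact2 rfil.
Proof.
move=> n a b ha hb e1 e2.
have /fin_all_exists [f hf] i : exists c : C^o,
    [/\ cfil (n - 1 - (e i)%:Z) c,
      a 0 i = d * c & b 0 i = - (kc beta * u) * c].
  have [||c [hc ec ec']] := cfil_exact2 (ha i) (hb i).
  - by have /rowP/(_ i) := e1; rewrite row_syzygyU mxE.
  - by have /rowP/(_ i) := e2; rewrite row_syzygyD mxE.
  by exists c; rewrite addrAC.
exists (\row_i f i); split=> [i||].
- by rewrite mxE; case: (hf i).
- by apply/rowP=> i; rewrite !mxE; case: (hf i).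
- by apply/rowP=> i; rewrite !mxE; case: (hf i).
Qed.

Lemma rfil_exact3 : koszul_exact3 rfil.
Proof.
move=> n c hc e1 e2; apply/rowP=> i; rewrite mxE.
apply: (cfil_exact3 (hc i)).
- by have /rowP/(_ i) := e1; rewrite !mxE.
- by have /rowP/(_ i) := e2; rewrite !mxE.
Qed.
End FreeModule.

Section Closure.
Variables (M : lmodType C) (F : int -> M -> Prop).
Hypothesis HF : filtration F.

Lemma fil_opp n x : F n x -> F n (- x).
Proof. by rewrite -[- x]add0r; apply: (fil_sub HF); apply: (fil_zero HF). Qed.

Lemma fil_add n x y : F n x -> F n y -> F n (x + y).
Proof. by move=> hx /fil_opp; rewrite -{2}[y]opprK; apply: (fil_sub HF). Qed.

Lemma fil_sum n I (r : seq I) (f : I -> M) : (forall i, F n (f i)) -> F n (\sum_(i <- r) f i).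
Proof.
move=> hf; elim/big_ind: _ => //; [exact: (fil_zero HF)|exact: fil_add].
Qed.

Lemma fil_syzygyU n a b : F (n - 2) a -> F (n - 2) b -> F n (syzygyU a b).
Proof.
move=> ha hb; have up x : F (n - 2) x -> F (n - 1) (u *: x).
  by move/(fil_u HF); have -> : n - 2 + 1 = n - 1 by lia.
have dp x : F (n - 2) x -> F (n - 1) (d *: x).
  by move/(fil_d HF); have -> : n - 2 + 1 = n - 1 by lia.
have uq x : F (n - 1) x -> F n (u *: x) by move/(fil_u HF); rewrite subrK.
have dq x : F (n - 1) x -> F n (d *: x) by move/(fil_d HF); rewrite subrK.
rewrite syzygyUE; apply: fil_add; last exact/dq/dp.
apply: (fil_sub HF); last by apply: (fil_scale HF); apply: (fil_mono HF _ ha); lia.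
by apply: (fil_sub HF); [exact/uq/dp|apply: (fil_scale HF); exact/dq/up].
Qed.

Lemma fil_syzygyD n a b : F (n - 2) a -> F (n - 2) b -> F n (syzygyD a b).
Proof.
move=> ha hb; have up x : F (n - 2) x -> F (n - 1) (u *: x).
  by move/(fil_u HF); have -> : n - 2 + 1 = n - 1 by lia.
have dp x : F (n - 2) x -> F (n - 1) (d *: x).
  by move/(fil_d HF); have -> : n - 2 + 1 = n - 1 by lia.
have uq x : F (n - 1) x -> F n (u *: x) by move/(fil_u HF); rewrite subrK.
have dq x : F (n - 1) x -> F n (d *: x) by move/(fil_d HF); rewrite subrK.
rewrite syzygyDE; apply: (fil_sub HF).
  by apply/fil_opp/(fil_scale HF)/uq/up.
apply: fil_add; last by apply: (fil_scale HF); apply: (fil_mono HF _ hb); lia.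
by apply: fil_add; apply: (fil_scale HF); [exact/uq/dp|exact/dq/up].
Qed.
End Closure.

Section Syzygies.
Variables (M : lmodType C) (F : int -> M -> Prop).
Hypothesis HF : filtration F.

(** Generation in the strict sense: the coefficients respect the filtration, so
that the associated graded module is generated as well. *)
Definition generates s (g : 'I_s -> M) (e : 'I_s -> nat) :=
  (forall i, F (e i)%:Z (g i)) /\
  (forall n x, F n x -> exists2 v, rfil e n v & x = lincomb g v).

Definition kerfil s (g : 'I_s -> M) (e : 'I_s -> nat) (n : int) (v : 'rV[C]_s) :=
  rfil e n v /\ lincomb g v = 0.

Variables (s : nat) (g : 'I_s -> M) (e : 'I_s -> nat).
Hypothesis Hg : generates g e.

Lemma fil_lincomb n v : rfil e n v -> F n (lincomb g v).
Proof.
move=> hv; apply: (fil_sum HF) => i.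
have := filM HF (hv i) (proj1 Hg i); by rewrite subrK.
Qed.

Lemma lincomb_u v : lincomb g (u *: v) = u *: lincomb g v. Proof. exact: linearZ. Qed.
Lemma lincomb_d v : lincomb g (d *: v) = d *: lincomb g v. Proof. exact: linearZ. Qed.

Lemma lincomb_syzygyU a b : lincomb g (syzygyU a b) = syzygyU (lincomb g a) (lincomb g b).
Proof. by rewrite /syzygyU linearD !linearZ. Qed.
Lemma lincomb_syzygyD a b : lincomb g (syzygyD a b) = syzygyD (lincomb g a) (lincomb g b).
Proof. by rewrite /syzygyD linearB linearN !linearZ. Qed.

Lemma syzygyUB (N : lmodType C) (a a' b b' : N) :
  syzygyU (a - a') (b - b') = syzygyU a b - syzygyU a' b'.
Proof. by rewrite /syzygyU !scalerBr opprD addrACA. Qed.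
Lemma syzygyDB (N : lmodType C) (a a' b b' : N) :
  syzygyD (a - a') (b - b') = syzygyD a b - syzygyD a' b'.
Proof. by rewrite /syzygyD !scalerBr !opprD addrACA. Qed.

Lemma kerfil_filtration : filtration (kerfil g e).
Proof.
have HR := rfil_filtration e.
split=> [n v w [hv v0] [hw w0]|n c v [hv v0]|n|m n v mn [hv v0]|n v [hv v0]|
         n v [hv v0]|n v n0 [hv _]].
- by split; [apply: (fil_sub HR)|rewrite linearB /= v0 w0 subrr].
- by split; [apply: (fil_scale HR)|rewrite linearZ /= v0 scaler0].
- by split; [apply: (fil_zero HR)|rewrite linear0].
- by split; [apply: (fil_mono HR mn)|].
- by split; [apply: (fil_u HR)|rewrite lincomb_u v0 scaler0].
- by split; [apply: (fil_d HR)|rewrite lincomb_d v0 scaler0].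
- exact: (fil_neg HR n0 hv).
Qed.

Lemma kerfil_exact3 : koszul_exact3 (kerfil g e).
Proof. by move=> n c [hc _]; apply: rfil_exact3 hc. Qed.

(** In the three lemmas below, exactness of the free module solves the equation in
the ambient module; the image of the solution in M is a cycle one spot to the left,
and lifting the element of which it is a boundary corrects the solution. *)
Lemma kerfil_exact2 : koszul_exact3 F -> koszul_exact2 (kerfil g e).
Proof.
move=> X3 n a b [ha a0] [hb b0] e1 e2.
have [c [hc ac bc]] := rfil_exact2 ha hb e1 e2.
exists c; split=> //; split=> //.
apply: (X3 (n - 1)); first exact: fil_lincomb.
  apply/eqP; have /eqP := b0; rewrite bc linearZ /= scaleNr -scalerA oppr_eq0.
  move/eqP/(congr1 ( *:%R (kc beta^-1))).
  by rewrite scalerA -rmorphM mulVf // rmorph1 scale1r scaler0 => ->.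
by rewrite -lincomb_d -ac.
Qed.

Lemma kerfil_exact1 : koszul_exact2 F -> koszul_exact1 (kerfil g e).
Proof.
move=> X2 n p q [hp p0] [hq q0] pq.
have [a [b [ha hb pE qE]]] := rfil_exact1 hp hq pq.
have [||c [hc ac bc]] := X2 _ _ _ (fil_lincomb ha) (fil_lincomb hb).
- by rewrite -lincomb_syzygyU -pE.
- by rewrite -lincomb_syzygyD -qE.
have [c' hc' cE] := proj2 Hg _ _ hc.
have HR := rfil_filtration e.
have [k1 k2] := syzygy_of_syzygy c'.
exists (a - d *: c'), (b - - (kc beta * u) *: c'); split.
- split; last by rewrite linearB /= lincomb_d -cE -ac subrr.
  by apply: (fil_sub HR) => //; have := fil_d HR hc'; rewrite subrK.
- split; last by rewrite linearB linearZ /= -cE -bc subrr.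
  apply: (fil_sub HR) => //; rewrite scaleNr -scalerA.
  have := fil_scale HR (- beta) (fil_u HR hc').
  by rewrite subrK rmorphN scaleNr.
- by rewrite syzygyUB k1 subr0.
- by rewrite syzygyDB k2 subr0.
Qed.

Lemma kerfil_exact0 : koszul_exact1 F -> koszul_exact0 (kerfil g e).
Proof.
move=> X1 n p q [hp p0] [hq q0] [hpq pq0].
have [p' [q' [hp' hq' pqE]]] := rfil_exact0 hp hq hpq.
have [|a [b [ha hb pE qE]]] := X1 _ _ _ (fil_lincomb hp') (fil_lincomb hq').
  by rewrite -lincomb_u -lincomb_d -linearD /= -pqE.
have [a' ha' aE] := proj2 Hg _ _ ha; have [b' hb' bE] := proj2 Hg _ _ hb.
have HR := rfil_filtration e.
exists (p' - syzygyU a' b'), (q' - syzygyD a' b'); split.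
- split; last by rewrite linearB /= lincomb_syzygyU -aE -bE -pE subrr.
  apply: (fil_sub HR) => //; exact: (fil_syzygyU HR ha' hb').
- split; last by rewrite linearB /= lincomb_syzygyD -aE -bE -qE subrr.
  apply: (fil_sub HR) => //; exact: (fil_syzygyD HR ha' hb').
- rewrite pqE (scalerBr u p') (scalerBr d q') [RHS]addrACA -opprD.
  by rewrite (syzygy_relation a' b') subr0.
Qed.
End Syzygies.

(** * Minimal generators *)

Section MinimalGenerators.
Variables (M : lmodType C) (F : int -> M -> Prop).
Hypothesis HF : filtration F.

Definition generated_by s :=
  exists (g : 'I_s -> M) (e : 'I_s -> nat), generates F g e.

(** A relation in which g i has an invertible constant coefficient, all terms being
of degree at most e i, expresses g i by the others. *)
Lemma generates_drop s (g : 'I_s -> M) (e : 'I_s -> nat) i v c :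
  generates F g e -> rfil e (e i) v -> lincomb g v = 0 ->
  v 0 i = kc c -> c != 0 -> generated_by s.-1.
Proof.
case: s g e i v => [|s] g e i v [ge gg] hv v0 vi c0; first by case: i vi {hv v0}.
exists (fun j => g (lift i j)), (fun j => e (lift i j)); split=> [j|n x /gg [w hw ->]].
  exact: ge.
pose w' : 'rV[C]_s.+1 := w - (w 0 i * kc c^-1) *: v.
have w'i : w' 0 i = 0.
  by rewrite !mxE vi -mulrA -rmorphM mulVf // rmorph1 mulr1 subrr.
have ew' : lincomb g w' = lincomb g w.
  by rewrite linearB linearZ /= v0 scaler0 subr0.
exists (\row_j w' 0 (lift i j)) => [j|]; last first.
  rewrite -ew' /lincomb (bigD1_ord i) //= w'i scale0r add0r.
  by apply: eq_bigr => j _; rewrite mxE.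
rewrite mxE /w' !mxE; apply: (fil_sub cfil_filtration); first exact: hw.
have h1 : cfil (n - (e i)%:Z) (w 0 i * kc c^-1).
  by have := filM cfil_filtration (hw i) (cfil_kc c^-1); rewrite addr0.
have := filM cfil_filtration h1 (hv (lift i j)).
by congr (cfil _ _); lia.
Qed.

(** Induction on the degree n of a relation v.  By minimality
v = w + u p + d q with all of w, p, q of degree n - 1.  Spot 0 of M replaces the
images of p and q by elements of degree n - 2, up to a solution of spot 1; lifting
everything back, the induction hypothesis gives v = w + u p2 + d q2 with p2, q2 of
degree n - 2, so that v has degree n - 1. *)
Lemma minimal_generators : koszul_exact0 F -> koszul_exact1 F -> (exists s, generated_by s) ->
  exists s (g : 'I_s -> M) (e : 'I_s -> nat),
    generates F g e /\ (forall v, lincomb g v = 0 -> v = 0).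
Proof.
move=> X0 X1 exs; have exb : exists s, `[< generated_by s >].
  by have [s hs] := exs; exists s; apply/asboolP.
case: (ex_minnP exb) => s /asboolP [g [e Hg]] smin.
exists s, g, e; split=> //.
have HR := rfil_filtration e.
suff inj (N : nat) n v : n < N%:Z -> rfil e n v -> lincomb g v = 0 -> v = 0.
  by move=> v v0; have [n hn] := rfil_exhaust e v; apply: (inj n.+1 n) => //; lia.
elim: N n v => [|N IH] n v nN hv v0; first exact: (fil_neg HR nN hv).
have [n0|n0] := ltrP n 0; first exact: (fil_neg HR n0 hv).
have {}IH w : rfil e (n - 1) w -> lincomb g w = 0 -> w = 0.
  by apply: IH; lia.
(* If e i = n, the constant term of v i vanishes by minimality; if e i < n, it fits
   into the filtration step n - 1; and if e i > n, then v i = 0. *)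
have /fin_all_exists [f hf] i : exists t : C * C * C,
    [/\ cfil (n - 1 - (e i)%:Z) t.1.1, cfil (n - 1 - (e i)%:Z) t.1.2,
      cfil (n - 1 - (e i)%:Z) t.2 & v 0 i = t.1.1 + u * t.1.2 + d * t.2].
  have [c [b [b' [hb hb' vE]]]] := cfil_split (hv i).
  exists (kc c, b, b') => /=; rewrite addrAC; split=> //; rewrite addrAC.
  have [lt|ge] := ltrP (e i)%:Z n.
    by apply: (fil_mono cfil_filtration _ (cfil_kc c)); lia.
  have vkc : v 0 i = kc c.
    have z := fil_neg cfil_filtration.
    by rewrite vE (z _ _ _ hb) ?(z _ _ _ hb') ?mulr0 ?addr0 //; lia.
  suff -> : c = 0 by rewrite rmorph0; apply: (fil_zero cfil_filtration).
  apply/eqP/negPn/negP => c0.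
  have [eq|ne] := eqVneq n (e i)%:Z.
    have := smin s.-1.
    case: s g e Hg smin v hv v0 i vkc eq ge {hb hb' vE IH HR nN}
      => [|s] g e Hg smin v hv v0 i vkc eq ge.
      by case: i vkc eq ge.
    rewrite /= ltnn => h; suff : false by []; apply: h; apply/asboolP.
    by apply: (generates_drop (i := i) Hg _ v0 vkc c0); rewrite -eq.
  have vi0 : v 0 i = 0 by apply: (fil_neg cfil_filtration _ (hv i)); lia.
  have := phi_kc c 0; rewrite -vkc vi0 phi_zero /delta0 /= mulr1 => /esym/eqP.
  by rewrite !polyC_eq0 (negPf c0).
pose w := \row_i (f i).1.1; pose p := \row_i (f i).1.2; pose q := \row_i (f i).2.
have hw : rfil e (n - 1) w by move=> i; rewrite mxE; case: (hf i).
have hp : rfil e (n - 1) p by move=> i; rewrite mxE; case: (hf i).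
have hq : rfil e (n - 1) q by move=> i; rewrite mxE; case: (hf i).
have vE : v = w + u *: p + d *: q.
  by apply/rowP=> i; rewrite !mxE; case: (hf i).
have lw : u *: lincomb g p + d *: lincomb g q = - lincomb g w.
  apply/eqP; rewrite -addr_eq0 addrC addrA; apply/eqP.
  by rewrite -(lincomb_u g) -(lincomb_d g) -!linearD /= -vE.
have [|p1 [q1 [hp1 hq1 pq]]] := X0 _ _ _ (fil_lincomb HF Hg hp) (fil_lincomb HF Hg hq).
  by rewrite lw; apply/(fil_opp HF)/(fil_lincomb HF Hg).
have [p2 hp2 p1E] := proj2 Hg _ _ hp1; have [q2 hq2 q1E] := proj2 Hg _ _ hq1.
have hp2' : rfil e (n - 1) p2 by apply: (fil_mono HR _ hp2); lia.
have hq2' : rfil e (n - 1) q2 by apply: (fil_mono HR _ hq2); lia.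
have pqE : u *: (lincomb g p - lincomb g p2) + d *: (lincomb g q - lincomb g q2) = 0.
  by rewrite !scalerBr addrACA -opprD pq p1E q1E subrr.
have [||a [b [ha hb pE qE]]] := X1 (n - 1) _ _ _ _ pqE.
- by rewrite -linearB; apply: (fil_lincomb HF Hg); apply: (fil_sub HR).
- by rewrite -linearB; apply: (fil_lincomb HF Hg); apply: (fil_sub HR).
have [a' ha' aE] := proj2 Hg _ _ ha; have [b' hb' bE] := proj2 Hg _ _ hb.
have pz : p - p2 - syzygyU a' b' = 0.
  apply: IH.
    by apply: (fil_sub HR); [exact: (fil_sub HR)|exact: (fil_syzygyU HR ha' hb')].
  rewrite [lincomb g (p - p2 - _)]linearB /= [lincomb g (p - p2)]linearB /=.
  by rewrite lincomb_syzygyU -aE -bE pE subrr.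
have qz : q - q2 - syzygyD a' b' = 0.
  apply: IH.
    by apply: (fil_sub HR); [exact: (fil_sub HR)|exact: (fil_syzygyD HR ha' hb')].
  rewrite [lincomb g (q - q2 - _)]linearB /= [lincomb g (q - q2)]linearB /=.
  by rewrite lincomb_syzygyD -aE -bE qE subrr.
have vE' : v = w + u *: p2 + d *: q2.
  have -> : v = v - (u *: (p - p2 - syzygyU a' b') + d *: (q - q2 - syzygyD a' b')).
    by rewrite pz qz !scaler0 addr0 subr0.
  rewrite (scalerBr u (p - p2)) (scalerBr d (q - q2)) addrACA -opprD (syzygy_relation a' b') subr0.
  rewrite vE !scalerBr opprD !opprB addrACA [u *: p2 - _]addrC [d *: q2 - _]addrC.
  by rewrite !addrA !addrK.
apply: IH => //; rewrite vE'; apply: (fil_add HR); first apply: (fil_add HR) => //.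
  by have := fil_u HR hp2; rewrite subrK.
by have := fil_d HR hq2; rewrite subrK.
Qed.
End MinimalGenerators.

(** * Leading monomials and finite generation of submodules *)

Section Leading.
Variables (s : nat) (e : 'I_s -> nat).
Implicit Types (v : 'rV[C]_s) (i : 'I_s) (j : int) (a b : nat).

Definition mcoef v i j a b : k := (phi (v 0 i) j)`_a`_b.

Definition mono_deg i j a b := (e i + `|j| + (a + b) * 2)%N.
(** Encodes the component i together with the sign of the position j. *)
Definition mono_col i j : nat := (i * 2 + (0 <= j)%R)%N.

(** Total degree comes first, so that reductions respect the filtration.  At equal
degree, the comparison of |j| makes the weights in the action of u and d harmless:
they occur only when a position gets closer to 0, and such terms are smaller.  The
exponent b of y is determined by the degree and the other data. *)
Definition mono_lt i j a b i' j' a' b' : Prop :=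
  (mono_deg i j a b < mono_deg i' j' a' b')%N \/ mono_deg i j a b = mono_deg i' j' a' b' /\
  ((`|j| < `|j'|)%N \/ `|j|%N = `|j'|%N /\
  ((mono_col i j < mono_col i' j')%N \/ mono_col i j = mono_col i' j' /\ (a < a')%N)).

Definition lead v i j a b := mcoef v i j a b != 0 /\
  forall i' j' a' b', mono_lt i j a b i' j' a' b' -> mcoef v i' j' a' b' = 0.

Lemma rfil_mcoef n v : rfil e n v <->
  (forall i j a b, n < (mono_deg i j a b)%:Z -> mcoef v i j a b = 0).
Proof.
rewrite /mono_deg; split=> [h i j a b nl|h i j a b nl]; last by apply: h; lia.
by apply: (h i j); lia.
Qed.

Lemma mcoef_eq0 v : (forall i j a b, mcoef v i j a b = 0) -> v = 0.
Proof.
move=> h; apply/rowP=> i; rewrite mxE; apply: phi_inj => j; rewrite phi_zero.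
by apply/polyP=> a; apply/polyP=> b; rewrite !coef0; apply: h.
Qed.

Lemma mcoef_sub v w i j a b : mcoef (v - w) i j a b = mcoef v i j a b - mcoef w i j a b.
Proof. by rewrite /mcoef !mxE phi_sub !coefB. Qed.

Lemma mcoef_kc c v i j a b : mcoef (kc c *: v) i j a b = c * mcoef v i j a b.
Proof. by rewrite /mcoef mxE (phi_scale HC) coef_cstM. Qed.

Lemma affine_coef0 (r w : R) a b : affine r ->
  (forall a', a = a'.+1 -> w`_a'`_b = 0) -> (forall b', b = b'.+1 -> w`_a`_b' = 0) ->
  w`_a`_b = 0 -> (r * w)`_a`_b = 0.
Proof.
move=> [p [q [c ->]]] h1 h2 h3.
rewrite !mulrDl -!mulrA !coefD !coef_cstM h3 mulr0 addr0 coef_vxM coef_vyM.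
by case: a b h1 h2 {h3} => [|a] [|b] h1 h2;
  rewrite ?(h1 _ erefl) ?(h2 _ erefl) !mulr0 addr0.
Qed.

(** A power of u is only lengthened here: at a negative position, u would
multiply the coefficient by a weight and mix the monomials x and y. *)
Lemma lead_u v i j a b : 0 <= j -> lead v i j a b -> lead (u *: v) i (j + 1) a b.
Proof.
move=> j0 [nz z].
have cfu i' j' a' b' : mcoef (u *: v) i' j' a' b' =
    (ucoef alpha beta gamma j' * phi (v 0 i') (j' - 1))`_a'`_b'.
  by rewrite /mcoef mxE (phi_u HC).
split.
  by rewrite cfu ucoef_pos ?mul1r ?addrK //; lia.
move=> i' j' a' b' h; rewrite cfu; case: (lerP 1 j') => j1.
  rewrite ucoef_pos // mul1r; apply: z.
  by move: h; rewrite /mono_lt /mono_deg /mono_col; lia.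
rewrite ucoef_neg; last lia.
apply: affine_coef0 => [|c cE|c cE|]; first exact: weight_affine; apply: z;
  by move: h; rewrite /mono_lt /mono_deg /mono_col; lia.
Qed.

Lemma lead_d v i j a b : j < 0 -> lead v i j a b -> lead (d *: v) i (j - 1) a b.
Proof.
move=> j0 [nz z].
have cfd i' j' a' b' : mcoef (d *: v) i' j' a' b' =
    (dcoef alpha beta gamma j' * phi (v 0 i') (j' + 1))`_a'`_b'.
  by rewrite /mcoef mxE (phi_d HC).
split.
  by rewrite cfd dcoef_neg ?mul1r ?subrK //; lia.
move=> i' j' a' b' h; rewrite cfd; case: (ltrP j' 0) => j1.
  rewrite dcoef_neg // mul1r; apply: z.
  by move: h; rewrite /mono_lt /mono_deg /mono_col; lia.
rewrite dcoef_pos //.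
apply: affine_coef0 => [|c cE|c cE|]; first exact: weight_affine; apply: z;
  by move: h; rewrite /mono_lt /mono_deg /mono_col; lia.
Qed.

(** Combinations of u d and d u act diagonally, by an affine form that depends on
the position; it can be prescribed at a given position. *)
Lemma diagonal_element p q j : exists2 c, cfil 2 c &
  exists L : int -> R, [/\ forall w n, phi (c * w) n = L n * phi w n,
    forall n, affine (L n) & L j = cst p * vx k + cst q * vy k].
Proof.
have [p' [q' [c' E]]] := weight_span alpha gamma beta_neq0 p q j.
have HF := cfil_filtration.
exists (kc p' * (u * d) + kc q' * (d * u) + kc c').
  have f0 : cfil 0 1 by rewrite -(rmorph1 kc); apply: cfil_kc.
  have h1 : cfil 2 (u * d).
    by have := fil_u HF (fil_d HF f0); rewrite /GRing.scale /= mulr1.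
  have h2 : cfil 2 (d * u).
    by have := fil_d HF (fil_u HF f0); rewrite /GRing.scale /= mulr1.
  apply: (fil_add HF); last by apply: (fil_mono HF _ (cfil_kc c')).
  by apply: (fil_add HF); apply: (fil_scale HF).
exists (fun n => cst p' * weight alpha beta gamma n
  + cst q' * weight alpha beta gamma (n + 1) + cst c').
split=> [w n|n|//]; last by apply: affine_comb; apply: weight_affine.
rewrite !mulrDl !(phi_add HC) -!mulrA !(phi_scale HC) (phi_u HC) (phi_d HC) (phi_d HC) (phi_u HC).
by rewrite model_ud // model_du // !mulrDl !mulrA.
Qed.

(** The multiplier is x only at the position j of the leading monomial.  At a
position that comes later in the order it is some affine form, but there the
monomials of v of the same degree would exceed the leading one, so they are
absent. *)
Lemma lead_x v i j a b : lead v i j a b ->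
  exists2 c, cfil 2 c & lead (c *: v) i j a.+1 b.
Proof.
move=> [nz z]; have [c hc [L [cL aL Lj]]] := diagonal_element 1 0 j.
have {}Lj : L j = vx k by rewrite Lj !polyC0 !polyC1 mul1r mul0r addr0.
have cfc i' j' a' b' : mcoef (c *: v) i' j' a' b' = (L j' * phi (v 0 i') j')`_a'`_b'.
  by rewrite /mcoef mxE cL.
exists c => //; split; first by rewrite cfc Lj coef_vxM.
move=> i' j' a' b' h; rewrite cfc.
have [[mE tE]|ne] := pselect (`|j|%N = `|j'|%N /\ mono_col i j = mono_col i' j').
  have jE : j' = j by move: mE tE; rewrite /mono_col; lia.
  have iE : i' = i by apply/val_inj; move: mE tE; rewrite /mono_col /=; lia.
  subst i' j'; rewrite Lj coef_vxM; case: a' h => [//|a'] h; apply: z.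
  by move: h; rewrite /mono_lt /mono_deg; lia.
apply: affine_coef0 => [//|c' cE|c' cE|]; apply: z;
  by move: h ne; rewrite /mono_lt /mono_deg; lia.
Qed.

Lemma lead_y v i j a b : lead v i j a b ->
  exists2 c, cfil 2 c & lead (c *: v) i j a b.+1.
Proof.
move=> [nz z]; have [c hc [L [cL aL Lj]]] := diagonal_element 0 1 j.
have {}Lj : L j = vy k by rewrite Lj !polyC0 !polyC1 mul1r mul0r add0r.
have cfc i' j' a' b' : mcoef (c *: v) i' j' a' b' = (L j' * phi (v 0 i') j')`_a'`_b'.
  by rewrite /mcoef mxE cL.
exists c => //; split; first by rewrite cfc Lj coef_vyM.
move=> i' j' a' b' h; rewrite cfc.
have [[mE tE]|ne] := pselect (`|j|%N = `|j'|%N /\ mono_col i j = mono_col i' j').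
  have jE : j' = j by move: mE tE; rewrite /mono_col; lia.
  have iE : i' = i by apply/val_inj; move: mE tE; rewrite /mono_col /=; lia.
  subst i' j'; rewrite Lj coef_vyM; case: b' h => [//|b'] h; apply: z.
  by move: h; rewrite /mono_lt /mono_deg; lia.
apply: affine_coef0 => [//|c' cE|c' cE|]; apply: z;
  by move: h ne; rewrite /mono_lt /mono_deg; lia.
Qed.

Lemma lead_raise v i j a b j' a' b' : (0 <= j) = (0 <= j') ->
  (`|j| <= `|j'|)%N -> (a <= a')%N -> (b <= b')%N -> lead v i j a b ->
  exists2 c, cfil ((mono_deg i j' a' b')%:Z - (mono_deg i j a b)%:Z) c & lead (c *: v) i j' a' b'.
Proof.
have HF := cfil_filtration.
have step n m c c' : cfil n c -> cfil m c' -> cfil (m + n) (c' * c).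
  by move=> hc hc'; apply: (filM HF hc' hc).
move=> sg jj /subnKC <- /subnKC <-.
elim: (b' - b)%N => [|y IHy] hv; last first.
  have [c hc /lead_y [c' hc' lc]] := IHy hv.
  exists (c' * c); last by rewrite addnS -scalerA.
  by move: (step _ _ _ _ hc hc'); congr (cfil _ _); rewrite /mono_deg; lia.
elim: (a' - a)%N => [|x IHx]; last first.
  have [c hc /lead_x [c' hc' lc]] := IHx.
  exists (c' * c); last by rewrite addnS -scalerA.
  by move: (step _ _ _ _ hc hc'); congr (cfil _ _); rewrite /mono_deg; lia.
rewrite !addn0.
suff [c hc lc] : exists2 c, cfil (`|j'| - `|j|)%N%:Z c & lead (c *: v) i j' a b.
  by exists c => //; move: hc; congr (cfil _ _); rewrite /mono_deg; lia.
have [n nE] : exists n, n = (`|j'| - `|j|)%N by exists (`|j'| - `|j|)%N.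
rewrite -nE; elim: n j' sg jj nE => [|n IHn] j' sg jj nE.
  have -> : j' = j by move: sg jj nE; lia.
  by exists 1; [rewrite -(rmorph1 kc); apply: cfil_kc|rewrite scale1r].
case: (lerP 0 j) => j0.
  have [|||c hc lc] := IHn (j' - 1); [lia..|].
  exists (u * c); first by have := fil_u HF hc; congr (cfil _ _); lia.
  by rewrite -scalerA -[j'](subrK 1); apply: lead_u => //; lia.
have [|||c hc lc] := IHn (j' + 1); [lia..|].
exists (d * c); first by have := fil_d HF hc; congr (cfil _ _); lia.
by rewrite -scalerA -[j'](addrK 1); apply: lead_d => //; lia.
Qed.

(** An order embedding of the monomials of bounded degree into nat, in base M; it
turns the reduction process into an induction on a natural number. *)
Definition mono_code M i j a b : nat :=
  (((mono_deg i j a b * M + `|j|) * M + mono_col i j) * M + a)%N.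

Lemma mono_code_lt M i j a b i' j' a' b' : (`|j| < M)%N -> (mono_col i j < M)%N -> (a < M)%N ->
  mono_lt i j a b i' j' a' b' -> (mono_code M i j a b < mono_code M i' j' a' b')%N.
Proof.
move=> jM tM aM h; rewrite /mono_code; apply: lex_code_lt => //.
case: h => [h|[-> [h|[-> [h|[-> h]]]]]]; [left..|right=> //].
- by apply: lex_code_lt => //; left; apply: lex_code_lt => //; left.
- by apply: lex_code_lt => //; left; apply: lex_code_lt => //; right.
- by apply: lex_code_lt => //; right.
Qed.

Lemma mono_lt_total i j a b i' j' a' b' : mono_lt i j a b i' j' a' b' \/
  mono_lt i' j' a' b' i j a b \/ [/\ i = i', j = j', a = a' & b = b'].
Proof.
have [] : mono_lt i j a b i' j' a' b' \/ mono_lt i' j' a' b' i j a b \/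
   mono_deg i j a b = mono_deg i' j' a' b' /\ `|j|%N = `|j'|%N /\ mono_col i j = mono_col i' j' /\ a = a'.
- rewrite /mono_lt; lia.
- by left.
case=> [h|[dE [jE [tE aE]]]]; [by right; left|right; right].
have iE : i = i' by apply/val_inj; move: tE; rewrite /mono_col /=; lia.
subst i'; split=> //; first by move: jE tE; rewrite /mono_col; lia.
by move: dE; rewrite /mono_deg; lia.
Qed.

(** Dickson's lemma gives finitely many elements of N whose leading monomials divide
those of all elements of N.  Subtracting multiples of them from v in N lowers its
leading monomial, and the multiples used have degree at most that of v. *)
Lemma submodule_generated (N : 'rV[C]_s -> Prop) :
  (forall v w, N v -> N w -> N (v - w)) -> (forall c v, N v -> N (c *: v)) ->
  exists r, generated_by (fun n v => rfil e n v /\ N v) r.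
Proof.
move=> NB NZ; pose pos (t : bool) (m : nat) : int := if t then Posz m else Negz m.
have [l [lT Tl]] := dickson_nat (dickson_nat (dickson_nat (@dickson_fin ('I_s * bool)%type)))
  (fun x => exists2 v, N v & lead v x.1.1.1.1 (pos x.1.1.1.2 x.1.1.2) x.1.2 x.2).
pose ix (t : 'I_(size l)) := tnth (in_tuple l) t.
have /fin_all_exists [g hg] t : exists v, N v /\
    lead v (ix t).1.1.1.1 (pos (ix t).1.1.1.2 (ix t).1.1.2) (ix t).1.2 (ix t).2.
  by have [|v Nv lv] := lT (ix t); [exact: mem_tnth|exists v].
pose e' t := mono_deg (ix t).1.1.1.1 (pos (ix t).1.1.1.2 (ix t).1.1.2) (ix t).1.2 (ix t).2.
exists (size l), g, e'; split=> [t|n v [hv Nv]].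
  have [Ng lg] := hg t; split=> //; apply/rfil_mcoef => i j a b h.
  by apply: (proj2 lg); left; rewrite /e' in h; lia.
have HR := rfil_filtration e; have HR' := rfil_filtration e'.
have [n0|n0] := ltrP n 0.
  exists 0; first exact: (fil_zero HR').
  by rewrite (fil_neg HR n0 hv) linear0.
case: n n0 hv => [n _ hv|//].
(* A base for [mono_code] that exceeds all digits of monomials of degree <= n. *)
pose M := (n + s * 2 + 2)%N.
have bound w i j a b : rfil e n w -> mcoef w i j a b != 0 ->
    [/\ (mono_deg i j a b <= n)%N, (`|j| < M)%N, (mono_col i j < M)%N & (a < M)%N].
  move=> /rfil_mcoef hw nz; have dn : (mono_deg i j a b <= n)%N.
    rewrite leqNgt; apply/negP=> lt; move/eqP: nz; apply; apply: hw; lia.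
  by split=> //; move: dn; rewrite /mono_deg /M /mono_col; have := ltn_ord i; lia.
have [m hm] : exists m, forall i j a b, mcoef v i j a b != 0 -> (mono_code M i j a b < m)%N.
  exists (n.+1 * M * M * M)%N => i j a b /(bound _ _ _ _ _ hv) [dn jM tM aM].
  have nest P p q : (q < M)%N -> (p < P)%N -> (p * M + q < P * M)%N.
    by move=> qM pP; rewrite -[(P * M)%N]addn0; apply: lex_code_lt => //; left.
  rewrite -ltnS in dn; exact: (nest _ _ _ aM (nest _ _ _ tM (nest _ _ _ jM dn))).
elim: m v hv Nv hm => [|m IH] v hv Nv hm.
  exists 0; first exact: (fil_zero HR').
  rewrite linear0; apply: mcoef_eq0 => i j a b; apply/eqP/negPn/negP => /hm.
  by rewrite ltn0.
have [[i [j [a [b [nz cE]]]]]|none] := pselect (exists i j a b,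
    mcoef v i j a b != 0 /\ mono_code M i j a b = m); last first.
  apply: IH => // i j a b nz; rewrite ltn_neqAle -ltnS hm // andbT.
  by apply/eqP=> cE; apply: none; exists i, j, a, b.
have [dn jM tM aM] := bound _ _ _ _ _ hv nz.
have lv : lead v i j a b.
  split=> // i' j' a' b' /(mono_code_lt jM tM aM) lt; apply/eqP/negPn/negP => /hm.
  by rewrite ltnS leqNgt -cE lt.
have [|x xl] := Tl (i, 0 <= j, (if (0 <= j)%R then `|j| else `|j|.-1)%N, a, b).
  exists v => //=; suff -> : pos (0 <= j) (if (0 <= j)%R then `|j| else `|j|.-1)%N = j by [].
  by rewrite /pos; case: (lerP 0 j) => h /=; lia.
move=> [[[/= xE x1] x2] x3].
(* The element g t, raised to the leading monomial of v, cancels it. *)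
have [t tE] : exists t, ix t = x.
  have /tnthP [t tE] : x \in in_tuple l by [].
  by exists t.
have [Ng lg] := hg t.
have e't : e' t = mono_deg (ix t).1.1.1.1 (pos (ix t).1.1.1.2 (ix t).1.1.2)
  (ix t).1.2 (ix t).2 by [].
rewrite tE xE /= in lg e't.
have [||c hc lc] := lead_raise _ _ x2 x3 lg (j' := j).
- by rewrite /pos; case: ifP; lia.
- by rewrite /pos; move: x1; case: ifP; lia.
rewrite -e't in hc.
pose q := mcoef v i j a b / mcoef (c *: g t) i j a b.
have [cnz cz] := lc; have Ncg : N (kc q *: (c *: g t)) by apply/NZ/NZ.
have hcg : rfil e n (kc q *: (c *: g t)).
  apply: (fil_scale HR); apply: (@fil_mono _ _ HR (mono_deg i j a b)%:Z); first lia.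
  by apply/rfil_mcoef=> i' j' a' b' h; apply: cz; left; lia.
have hv' : rfil e n (v - kc q *: (c *: g t)) by apply: (fil_sub HR).
have [||i' j' a' b' nz'|w hw wE] := IH (v - kc q *: (c *: g t)) => //.
- exact: NB.
- have [dn' jM' tM' aM'] := bound _ _ _ _ _ hv' nz'; rewrite -cE.
  case: (mono_lt_total i' j' a' b' i j a b) => [h|[h|[iE jE aE bE]]].
  + exact: mono_code_lt.
  + by move: nz'; rewrite mcoef_sub mcoef_kc (proj2 lv _ _ _ _ h) (cz _ _ _ _ h) mulr0 subrr eqxx.
  + by move: nz'; subst i' j' a' b'; rewrite mcoef_sub mcoef_kc divfK // subrr eqxx.
exists (w + (kc q * c) *: delta_mx 0 t); last first.
  by rewrite linearD linearZ /= lincomb_delta -wE -scalerA subrK.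
apply: (fil_add HR') => // t'; rewrite !mxE eqxx /=.
case: eqP => [->|_]; last by rewrite mulr0; apply: (fil_zero cfil_filtration).
rewrite mulr1; apply: (fil_scale cfil_filtration).
by apply: (fil_mono cfil_filtration _ hc); lia.
Qed.
End Leading.

(** * The resolution *)

Section FiniteResolution.

Lemma kerfil_generated (M : lmodType C) s (g : 'I_s -> M) e :
  exists r, generated_by (kerfil g e) r.
Proof.
have kB v w : lincomb g v = 0 -> lincomb g w = 0 -> lincomb g (v - w) = 0.
  by move=> v0 w0; rewrite linearB /= v0 w0 subrr.
have kZ c v : lincomb g v = 0 -> lincomb g (c *: v) = 0.
  by move=> v0; rewrite linearZ /= v0 scaler0.
exact: (submodule_generated e kB kZ).
Qed.

Lemma kerfil_image (M : lmodType C) s (g : 'I_s -> M) e r (g' : 'I_r -> 'rV[C]_s) e' :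
  generates (kerfil g e) g' e' ->
  forall v, lincomb g v = 0 <-> exists w, lincomb g' w = v.
Proof.
move=> Hg' v; split=> [v0|[w <-]].
  have [n hn] := rfil_exhaust e v.
  by have [w _ ->] := proj2 Hg' n v (conj hn v0); exists w.
have [n hn] := rfil_exhaust e' w.
by have [_] := fil_lincomb (kerfil_filtration g e) Hg' hn.
Qed.

(** The generators of P may be given any degrees, say 0, since K1 is a submodule of
a free module in any case.  K1, ..., K4 being the successive kernels, exactness
spreads as follows: K1 at spot 3, K2 at spots 2 and 3, K3 at spots 1 and 2, K4 at
spots 0 and 1; so K4 has a basis. *)
Theorem projective_stably_free (P : lmodType C) :
  fin_generated P -> projective P -> stably_free P.
Proof.
move=> [s0 [g0 g0s]] projP.
pose e0 (i : 'I_s0) := 0%N.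
have H1 := kerfil_filtration g0 e0.
have [s1 [g1 [e1 G1]]] := kerfil_generated g0 e0.
have H2 := kerfil_filtration g1 e1.
have [s2 [g2 [e2 G2]]] := kerfil_generated g1 e1.
have H3 := kerfil_filtration g2 e2.
have [s3 [g3 [e3 G3]]] := kerfil_generated g2 e2.
have X13 := @kerfil_exact3 _ _ g0 e0.
have X22 := kerfil_exact2 H1 G1 X13; have X23 := @kerfil_exact3 _ _ g1 e1.
have X31 := kerfil_exact1 H2 G2 X22; have X32 := kerfil_exact2 H2 G2 X23.
have X40 := kerfil_exact0 H3 G3 X31; have X41 := kerfil_exact1 H3 G3 X32.
have [s4 [g4 [e4 [G4 inj4]]]] :=
  minimal_generators (kerfil_filtration g3 e3) X40 X41 (kerfil_generated g3 e3).
apply: (@resolution_stably_free C P s0 s1 s2 s3 s4 (lincomb g0) (lincomb g1)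
   (lincomb g2) (lincomb g3) (lincomb g4)) => //.
- move=> x; have [c ->] := g0s x; exists (\row_i c i).
  by apply: eq_bigr => i _; rewrite mxE.
- exact: kerfil_image G1.
- exact: kerfil_image G2.
- exact: kerfil_image G3.
- exact: kerfil_image G4.
Qed.
End FiniteResolution.
End FilteredModules.
End NormalForm.

Theorem theorem2p1 (k : fieldType) (alpha beta gamma : k) (hbeta : beta != 0) :
  psf_ring (downup alpha beta gamma).
Proof.
pose S := downup alpha beta gamma.
pose U : S := downupU alpha beta gamma; pose D : S := downupD alpha beta gamma.
pose f (c : k) : S^c := c%:A : S.
have fB : zmod_morphism f by move=> a b; exact: scalerBl.
have fM : monoid_morphism f.
  split=> [|a b]; first exact: scale1r.
  by rewrite /f mulrC; exact: (rmorphM (in_alg S)).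
pose fBm := GRing.isZmodMorphism.Build _ _ f fB.
pose fMm := GRing.isMonoidMorphism.Build _ _ f fM.
pose kc : {rmorphism k -> S^c} := HB.pack f fBm fMm.
have kcl c (a : S) : a * (c%:A : S) = c *: a by rewrite mulr_algr.
have kcr c (a : S) : (c%:A : S) * a = c *: a by rewrite mulr_algl.
have [phi [phiD phiZ phi1 phiU phiDn]] := downup_model alpha gamma hbeta.
have HC : is_downup alpha beta gamma (downupU alpha beta gamma : S^c)
   (downupD alpha beta gamma : S^c) kc phi.
  split=> //.
  - by move=> c a; exact: etrans (kcl c a) (esym (kcr c a)).
  - have : D * (U * U) = U * (D * U) * (alpha%:A : S) + U * (U * D) * (beta%:A : S)
        + U * (gamma%:A : S) by rewrite !kcl !mulrA -mulrA -!expr2 downup_rel1.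
    by [].
  - have : D * (D * U) = D * (U * D) * (alpha%:A : S) + U * (D * D) * (beta%:A : S)
        + D * (gamma%:A : S) by rewrite !kcl mulrA -!expr2 downup_rel2 !mulrA.
    by [].
  - by move=> c a n; rewrite -phiZ -kcl.
  - move=> Q QD QZ; apply: downup_ind => // c a Qa.
    by rewrite -kcl; exact: QZ.
move=> P; exact: (projective_stably_free hbeta HC).
Qed.
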